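(* Let $C>0$ and let $0\le p_0\in L^\infty(\mathbb{R}^d)$ with $\|p_0\|_{L^\infty(\mathbb{R}^d)}\le C$. Assume that $c_1<\infty$ and $c_4<\infty$ and, moreover, for a.a. $x,y\in\mathbb{R}^d$, $$\int_{\mathbb{R}^d}\int_{\mathbb{R}^d}c(y,u_1,x,u_2)\,du_1du_2\le\int_{\mathbb{R}^d}\int_{\mathbb{R}^d}c(x,y,u_1,u_2)\,du_1du_2 .$$ Then, for any $T>0$, there exists a function $0\le p_t\in L^\infty(\mathbb{R}^d)$, $t\in[0,T]$, with value $p_0$ at $t=0$, which solves the equation $$\frac{\partial}{\partial t}p_t(x)=\int_{\mathbb{R}^d}\int_{\mathbb{R}^d}\tilde c(y_1,y_2,x)\,p_t(y_1)p_t(y_2)\,dy_1dy_2-p_t(x)\int_{\mathbb{R}^d}a_1(x,x_2)\,p_t(x_2)\,dx_2$$ and, moreover, $$\max_{t\in[0,T]}\|p_t\|_{L^\infty(\mathbb{R}^d)}\le C .$$ This function is the unique non-negative solution of the equation (with initial value $p_0$) which satisfies the last bound.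
   Context: $d\in\mathbb{N}$. The rate $c:(\mathbb{R}^d)^4\to[0,\infty)$ is measurable, depends only on the unordered pairs $\{x_1,x_2\}$, $\{y_1,y_2\}$, i.e. $c(x_1,x_2,y_1,y_2)=c(x_2,x_1,y_1,y_2)=c(x_1,x_2,y_2,y_1)$, and satisfies $c(x_1,x_2,\cdot,\cdot)\in L^1_{\mathrm{loc}}(\mathbb{R}^d\times\mathbb{R}^d)$ for a.a. $x_1,x_2\in\mathbb{R}^d$. Put (all integrals over $\mathbb{R}^d$) $$c_1=\operatorname*{ess\,sup}_{x_1,x_2}\iint c(x_1,x_2,y_1,y_2)\,dy_1dy_2,\qquad c_4=\operatorname*{ess\,sup}_{x_1}\iiint c(y_1,y_2,x_1,x_2)\,dy_1dy_2dx_2,$$ $$a_1(x_1,x_2)=\iint c(x_1,x_2,y_1,y_2)\,dy_1dy_2,\qquad \tilde c(x_1,x_2,y_1)=\int c(x_1,x_2,y_1,y_2)\,dy_2 .$$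
   Formalization: The formal theorem also assumes that for every u in L^∞ the loss integral ∫a_1(x,x_2)u(x_2)dx_2 converges for a.a. x; c_1, c_4 < ∞ do not imply this, and without it the claim fails for p_0 = C. *)

(* Defs.v *)
From HB Require Import structures.
From mathcomp Require Import all_boot all_order all_algebra.
From mathcomp Require Import all_classical all_reals all_analysis.
From mathcomp Require Import ess_sup_inf.

Set Implicit Arguments.
Unset Strict Implicit.
Unset Printing Implicit Defensive.

Import Order.TTheory GRing.Theory Num.Theory.
Import numFieldNormedType.Exports.

Local Open Scope classical_set_scope.
Local Open Scope ring_scope.
Local Open Scope ereal_scope.

(* R^d, with the product of the Borel sigma-algebras of the coordinates. *)
Notation Rd R d := (d.-tuple (measurableTypeR R)).

Definition consRd (R : realType) (n : nat)
    (z : measurableTypeR R * Rd R n) : Rd R n.+1 :=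
  [the n.+1.-tuple (measurableTypeR R) of z.1 :: z.2].

Lemma measurable_consRd (R : realType) (n : nat) :
  measurable_fun [set: measurableTypeR R * Rd R n] (@consRd R n).
Proof. exact: measurable_cons. Qed.

Lemma sigma_finite_prod d1 d2 (T1 : measurableType d1) (T2 : measurableType d2)
    (R : realType) (m1 : {sigma_finite_measure set T1 -> \bar R})
    (m2 : {sigma_finite_measure set T2 -> \bar R}) :
  sigma_finite setT (m1 \x m2).
Proof.
have /sigma_finiteP[F [TF ndF Foo]] := sigma_finiteT m1.
have /sigma_finiteP[G [TG ndG Goo]] := sigma_finiteT m2.
exists (fun n => F n `*` G n).
  rewrite -setXTT TF TG predeqE => -[x y]; split.
    move=> [/= [n _ Fnx] [k _ Gky]]; exists (maxn n k) => //; split.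
    - by move: x Fnx; exact/subsetPset/ndF/leq_maxl.
    - by move: y Gky; exact/subsetPset/ndG/leq_maxr.
  by move=> [n _ []/= ? ?]; split; exists n.
move=> k; have [? ?] := Foo k; have [? ?] := Goo k.
split; first exact: measurableX.
by rewrite product_measure1E// lte_mul_pinfty// ge0_fin_numE.
Qed.

Section lebesgue_cons.
Context (R : realType) (n : nat).
Variable m : {sigma_finite_measure set (Rd R n) -> \bar R}.

Definition lebesgue_cons : set (Rd R n.+1) -> \bar R :=
  pushforward ((@lebesgue_measure R) \x m) (@consRd R n).

Let lebesgue_cons0 : lebesgue_cons set0 = 0.
Proof. by rewrite /lebesgue_cons /pushforward preimage_set0 measure0. Qed.

Let lebesgue_cons_ge0 A : 0 <= lebesgue_cons A.
Proof. by rewrite /lebesgue_cons /pushforward. Qed.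

Let measurable_preimage_cons A :
  measurable A -> measurable (@consRd R n @^-1` A).
Proof. by move=> mA; rewrite -[X in measurable X]setTI; exact: measurable_consRd. Qed.

Let lebesgue_cons_sigma_additive : semi_sigma_additive lebesgue_cons.
Proof.
move=> F mF tF mUF; rewrite /lebesgue_cons /pushforward preimage_bigcup.
apply: measure_semi_sigma_additive.
- by move=> k; exact: measurable_preimage_cons.
- apply/trivIsetP => /= i j _ _ ij; rewrite -preimage_setI.
  by move/trivIsetP : tF => /(_ _ _ _ _ ij) ->//; rewrite preimage_set0.
- by rewrite -preimage_bigcup; exact: measurable_preimage_cons.
Qed.

HB.instance Definition _ := isMeasure.Build _ _ _ lebesgue_cons
  lebesgue_cons0 lebesgue_cons_ge0 lebesgue_cons_sigma_additive.

Let lebesgue_cons_sigma_finite : sigma_finite setT lebesgue_cons.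
Proof.
have [F TF Foo] := sigma_finite_prod (@lebesgue_measure R) m.
pose g (x : Rd R n.+1) : measurableTypeR R * Rd R n :=
  (tnth x ord0, [tuple of behead x]).
have mg : measurable_fun setT g.
  by apply: measurable_fun_pair; [exact: measurable_tnth|exact: measurable_behead].
have gK z : g (consRd z) = z.
  case: z => a x; rewrite /g /consRd; congr pair => //.
  exact/val_inj.
exists (fun k => g @^-1` F k).
  by rewrite -preimage_bigcup -TF preimage_setT.
move=> k; have [mFk Fk] := Foo k; split.
  by rewrite -[X in measurable X]setTI; exact: mg.
rewrite /lebesgue_cons /pushforward -comp_preimage.
by rewrite (_ : g \o _ = id) ?preimage_id//; apply/funext => z; exact: gK.
Qed.

HB.instance Definition _ := Measure_isSigmaFinite.Build _ _ _ lebesgue_cons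
  lebesgue_cons_sigma_finite.

End lebesgue_cons.

(* Lebesgue measure on R^d; R^0 is a point, of mass 1. *)
Fixpoint leb_rec (R : realType) (d : nat) :
    {sigma_finite_measure set (Rd R d) -> \bar R} :=
  match d with
  | 0%N => @dirac _ (Rd R 0) [tuple] R
  | n.+1 => lebesgue_cons (leb_rec R n)
  end.
Notation leb := (@leb_rec _ _).

Lemma leb_box (R : realType) (d : nat) (A : 'I_d -> set (measurableTypeR R)) :
  (forall i, measurable (A i)) ->
  leb [set x : Rd R d | forall i, A i (tnth x i)]
  = \prod_(i < d) (@lebesgue_measure R) (A i).
Proof.
elim: d A => [|n IH] A mA.
  by rewrite big_ord0 /= diracE mem_set//= => -[].
have mB : measurable [set x : Rd R n | forall i, A (lift ord0 i) (tnth x i)].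
  rewrite (_ : [set x | _] =
    \bigcap_(i in [set: 'I_n]) ((fun x => tnth x i) @^-1` A (lift ord0 i))).
    apply: fin_bigcap_measurable => // i _.
    rewrite -[X in measurable X]setTI.
    exact: measurable_tnth.
  by apply/seteqP; split => x /= h i; [move=> _; exact: h|exact: h].
rewrite big_ord_recl -IH// /= /lebesgue_cons /pushforward.
rewrite -product_measure1E//; congr (_ \x _).
apply/seteqP; split => -[a x] /=.
  move=> h; split; first by have := h ord0; rewrite (tnth_nth a).
  by move=> i; have := h (lift ord0 i); rewrite /consRd tnthS.
move=> [Aa h] i; case: (unliftP ord0 i) => [j|] ->.
  by rewrite /consRd tnthS; exact: h.
by rewrite (tnth_nth a).
Qed.

Section binary_jumps.
Context (R : realType) (d : nat).
Local Notation E := (Rd R d).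
Variable c : E -> E -> E -> E -> R.

(* L^1_loc(R^d x R^d): integrability over the compact sets, which are taken in
   the topological space 'rV_d * 'rV_d after identifying tuples and rows. *)
Definition rows_of (y : E * E) : 'rV[R]_d * 'rV[R]_d :=
  (\row_i (tnth y.1 i : R), \row_i (tnth y.2 i : R))%R.

Definition L1loc2 (f : E * E -> R) : Prop :=
  measurable_fun [set: E * E] f /\
  forall K : set ('rV[R]_d * 'rV[R]_d), compact K ->
    \int[leb \x leb]_(y in rows_of @^-1` K) `|f y|%:E < +oo.

Record is_rate : Prop := IsRate {
  rate_ge0 : forall x1 x2 y1 y2, (0 <= c x1 x2 y1 y2)%R ;
  rate_measurable : measurable_fun [set: E * E * E * E]
    (fun z => c z.1.1.1 z.1.1.2 z.1.2 z.2) ;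
  rate_symx : forall x1 x2 y1 y2, c x1 x2 y1 y2 = c x2 x1 y1 y2 ;
  rate_symy : forall x1 x2 y1 y2, c x1 x2 y1 y2 = c x1 x2 y2 y1 ;
  rate_L1loc : {ae leb \x leb, forall x : E * E,
    L1loc2 (fun y => c x.1 x.2 y.1 y.2)} }.

Definition a1 (x1 x2 : E) : \bar R :=
  \int[leb]_y1 \int[leb]_y2 (c x1 x2 y1 y2)%:E.

Definition ctilde (x1 x2 y1 : E) : \bar R := \int[leb]_y2 (c x1 x2 y1 y2)%:E.

Definition c1 : \bar R := ess_sup (leb \x leb) (fun x : E * E => a1 x.1 x.2).

Definition c4 : \bar R := ess_sup leb (fun x1 : E =>
  \int[leb]_y1 \int[leb]_y2 \int[leb]_x2 (c y1 y2 x1 x2)%:E).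

(* The right-hand side of the equation, in [-oo, +oo]. *)
Definition kinetic_rhs (p : E -> R) (x : E) : \bar R :=
  \int[leb]_y1 \int[leb]_y2 (ctilde y1 y2 x * (p y1)%:E * (p y2)%:E)
  - (p x)%:E * \int[leb]_x2 (a1 x x2 * (p x2)%:E).

Definition Linf (p : E -> R) : Prop := p \in Lfun leb +oo.

Definition Linf_norm (f : E -> \bar R) : \bar R := 'N[leb]_+oo[f].

(* The integral in the loss term of the equation converges for every function
   of L^oo.  For the gain term this follows from [c4 < +oo]; for the loss term
   it does not follow from [c1 < +oo] and [c4 < +oo]. *)
Definition loss_well_defined : Prop :=
  forall u : E -> R, Linf u -> {ae leb, forall x,
    leb.-integrable [set: E] (fun x2 => a1 x x2 * (u x2)%:E)}.

(* [p] is a nonnegative solution on [0, T]: the equation holds in L^oo at every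
   t, i.e. the difference quotients tend to the right-hand side in the norm of
   L^oo; the derivative is one-sided at t = 0 and t = T.  In particular
   t |-> p t is continuous into L^oo and the right-hand side is a.e. finite. *)
Record nonneg_solution (T : R) (p0 : E -> R) (p : R -> E -> R) : Prop :=
  NonnegSolution {
  sol_Linf : forall t, (0 <= t <= T)%R -> Linf (p t) ;
  sol_ge0 : forall t, (0 <= t <= T)%R ->
    {ae leb, forall x, (0 <= p t x)%R} ;
  sol_init : {ae leb, forall x, p 0%R x = p0 x} ;
  sol_deriv : forall t, (0 <= t <= T)%R ->
    Linf_norm (fun x =>
        ((p s x - p t x) / (s - t))%:E - kinetic_rhs (p t) x)
      @[s --> within [set s | (0 <= s <= T)%R] t^'] --> 0 }.

Definition bounded_by (T C : R) (p : R -> E -> R) : Prop :=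
  forall t, (0 <= t <= T)%R -> Linf_norm (EFin \o p t) <= C%:E.

End binary_jumps.

(* Main.v *)
Require Import Defs.
From HB Require Import structures.
From mathcomp Require Import all_boot all_order all_algebra.
From mathcomp Require Import all_classical all_reals all_analysis.
From mathcomp Require Import ess_sup_inf measurable_realfun.
From mathcomp Require Import ring lra.

(* Write G and L for the gain and loss operators, so that the equation reads
   p' = G(p, p) - p L(p), and let A(x) be the integral of a_1(x, .).

   Integrating the comparison hypothesis over x gives A(y) <= A(y), with A
   finite almost everywhere because the loss term makes sense; so equality
   holds pointwise in the hypothesis, and integrating it over y instead yields
   A(x) <= c_4.  Hence G and L are bounded on L^oo, G(v, u) <= C L(v) when
   0 <= u, v <= C, and with h = 1 / (C c_4) the map
   S(v, u) = u + h (G(v, u) - u L(v)) preserves the bounds 0 and C.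

   The equation is now h p' = S(p, p) - p with S affine in each argument, and
   it is solved by the Wild sum p_t = sum_n e^(-t/h) (1 - e^(-t/h))^n q_n, where
   q_0 = p_0 and n q_n is the sum of S(q_(n-1-k), q_k) over k < n.  All the q_n,
   and so all their convex combinations, lie between 0 and C.

   Uniqueness is Gronwall's lemma for the L^oo norm of a difference. *)

Import Order.TTheory GRing.Theory Num.Theory.
Import numFieldNormedType.Exports.

Set Implicit Arguments.
Unset Strict Implicit.
Unset Printing Implicit Defensive.

Local Open Scope classical_set_scope.
Local Open Scope ring_scope.

(** * Power series in the unit disk *)

(** Course-of-values recursion: [w n] is a table that is final up to index [n], and the diagonal
    [w n n] reads off the sequence. The Wild coefficients, each of which involves all earlier ones,
    are obtained this way. *)
Lemma history_recursion (A : Type) (a : A) (F : nat -> (nat -> A) -> A) :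
  (forall n f g, (forall k, (k <= n)%N -> f k = g k) -> F n f = F n g) ->
  exists q : nat -> A, q 0%N = a /\ forall n, q n.+1 = F n q.
Proof.
move=> FP.
pose w := fix w n : nat -> A := match n with
  | 0 => fun _ => a
  | m.+1 => fun k => if (k <= m)%N then w m k else F m (w m)
  end.
have wE m k : (k <= m)%N -> w m k = w k k.
  elim: m => [|m IH]; first by rewrite leqn0 => /eqP ->.
  rewrite leq_eqVlt => /predU1P[->//|]; rewrite ltnS => km /=.
  by rewrite km IH.
exists (fun n => w n n); split => // n /=.
by rewrite ltnn; apply: FP => k kn; rewrite wE.
Qed.

Section power_series.
Variable R : realType.
Implicit Types (a : nat -> R) (r : R).

(* The radius of convergence is at least 1. *)
Definition subexp a : Prop :=
  forall r, 0 <= r < 1 -> exists M, forall n, `|a n| * r ^+ n <= M.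

Lemma bounded_subexp a M : (forall n, `|a n| <= M) -> subexp a.
Proof.
move=> aM r /andP[r0 r1]; exists M => n.
by rewrite (le_trans _ (aM n))// ler_piMr// exprn_ile1// ltW.
Qed.

(** Every [r ^+ k] with [k <= n] is at least [r ^+ n], so the left-hand side is at most a partial
    geometric sum. The induction on [m] adds its terms one at a time with [n] fixed. *)
Lemma natr_exp_le r n : 0 <= r < 1 -> n.+1%:R * r ^+ n <= (1 - r)^-1.
Proof.
move=> /andP[r0 r1].
rewrite -[leRHS]mul1r ler_pdivlMr ?subr_gt0//.
suff H m : (m <= n)%N -> m.+1%:R * r ^+ n * (1 - r) <= 1 - r ^+ m.+1.
  by rewrite (le_trans (H n _))// gerBl exprn_ge0.
elim: m => [|m IH mn].
  by rewrite mul1r expr1 ler_piMl ?exprn_ile1 ?subr_ge0 ?(ltW r1).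
rewrite -natr1 !mulrDl mul1r.
have rnm : r ^+ n <= r ^+ m.+1 by rewrite ler_wiXn2l// ltW.
have := IH (ltnW mn); rewrite [r ^+ m.+2]exprS.
have : r ^+ n * (1 - r) <= r ^+ m.+1 * (1 - r).
  by rewrite ler_wpM2r// subr_ge0 ltW.
lra.
Qed.

(** Moving to a radius [s] with [r < s < 1] leaves a factor [(r / s) ^+ n], which absorbs the factor
    [n + 1] of the differentiated series by [natr_exp_le]. *)
Lemma subexp_diffs a : subexp a -> subexp (pseries_diffs a).
Proof.
move=> sa r /andP[r0 r1].
have [s rs s1] : exists2 s, r < s & s < 1 by exists ((r + 1) / 2); lra.
have s0 : 0 < s by apply: le_lt_trans rs.
have [|M aM] := sa s; first by rewrite s1 ltW.
pose w := r / s.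
have w01 : 0 <= w < 1 by rewrite divr_ge0// ?ltW//= ltr_pdivrMr// mul1r.
have M0 : 0 <= M by apply: le_trans (aM 0%N); rewrite expr0 mulr1.
exists ((1 - w)^-1 * (M / s)) => n; rewrite /pseries_diffs normrM normr_nat.
have -> : n.+1%:R * `|a n.+1| * r ^+ n =
    (n.+1%:R * w ^+ n) * (`|a n.+1| * s ^+ n.+1 / s).
  have sn0 : s ^+ n != 0 by rewrite expf_neq0// gt_eqF.
  by rewrite /w expr_div_n exprS; field; rewrite sn0 gt_eqF.
have [w0 _] := andP w01.
apply: ler_pM.
- by rewrite mulr_ge0 ?exprn_ge0.
- by rewrite divr_ge0 ?mulr_ge0 ?exprn_ge0 ?(ltW s0).
- exact: natr_exp_le.
- by rewrite ler_pM2r ?invr_gt0.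
Qed.

(** Comparison with a geometric series of ratio [|r| / s], where [|r| < s < 1]. *)
Lemma subexp_cvg a r : subexp a -> `|r| < 1 -> cvgn (pseries a r).
Proof.
move=> sa r1.
have [s rs s1] : exists2 s, `|r| < s & s < 1 by exists ((`|r| + 1) / 2); lra.
have s0 : 0 < s by apply: le_lt_trans rs.
have [|M aM] := sa s; first by rewrite s1 ltW.
have w1 : `| `|r| / s| < 1.
  by rewrite ger0_norm ?divr_ge0 ?(ltW s0)// ltr_pdivrMr// mul1r.
apply: normed_cvg; rewrite /pseries /=.
apply: (@series_le_cvg _ _ (geometric M (`|r| / s))) => [n|n|n|].
- by rewrite normr_ge0.
- rewrite /geometric /= mulr_ge0 ?exprn_ge0 ?divr_ge0 ?(ltW s0)//.
  by apply: le_trans (aM 0%N); rewrite mulr_ge0 ?exprn_ge0// ltW.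
- rewrite /geometric /= normrM normrX expr_div_n mulrA ler_pdivlMr ?exprn_gt0//.
  by rewrite mulrAC ler_wpM2r ?exprn_ge0.
- exact: is_cvg_geometric_series.
Qed.

Lemma is_derive_pseries a r : subexp a -> `|r| < 1 ->
  is_derive r 1 (fun y => limn (pseries a y)) (limn (pseries (pseries_diffs a) r)).
Proof.
move=> sa r1.
have [s rs s1] : exists2 s, `|r| < s & s < 1 by exists ((`|r| + 1) / 2); lra.
have s0 : 0 < s by apply: le_lt_trans rs.
have ns1 : `|s| < 1 by rewrite gtr0_norm.
apply: (@pseries_snd_diffs _ _ s); last by rewrite (gtr0_norm s0).
- exact: subexp_cvg.
- exact/subexp_cvg/ns1/subexp_diffs.
- exact/subexp_cvg/ns1/subexp_diffs/subexp_diffs.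
Qed.

(** When [N] grows by one, the left side gains one antidiagonal; on the right each row gains a last
    entry and a new row of length one appears. *)
Lemma triangle_sum (f : nat -> nat -> R) N :
  \sum_(n < N) \sum_(k < n.+1) f k (n - k)%N =
  \sum_(k < N) \sum_(l < (N - k)%N) f k l.
Proof.
elim: N => [|N IH]; first by rewrite !big_ord0.
rewrite big_ord_recr/= IH [in RHS]big_ord_recr/= subSnn big_ord1 big_ord_recr/=.
rewrite subnn addrA; congr (_ + _); rewrite -big_split/=; apply: eq_bigr => k _.
by rewrite subSn ?big_ord_recr// ltnW.
Qed.

Lemma le_sum_widen (f : nat -> R) m n : (m <= n)%N -> (forall i, 0 <= f i) ->
  \sum_(i < m) f i <= \sum_(i < n) f i.
Proof.
move=> mn f0; rewrite -!(big_mkord xpredT) (big_cat_nat _ mn)//=.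
by rewrite lerDl sumr_ge0.
Qed.

(* The square of side [N] lies between the triangles of sides [N] and [2N]. *)
Lemma cauchy_product_cvg (f : nat -> nat -> R) (l s : R) :
  (forall i j, 0 <= f i j) ->
  \sum_(n < N) \sum_(k < n.+1) f k (n - k)%N @[N --> \oo] --> l ->
  \sum_(k < N) \sum_(j < N) f k j @[N --> \oo] --> s -> l = s.
Proof.
move=> f0 fl fs; apply/esym/(cvg_unique _ fs) => //.
apply: (@squeeze_cvgr _ _ _ _
    (fun N => \sum_(n < N) \sum_(k < n.+1) f k (n - k)%N)
    (fun N => \sum_(n < N + N) \sum_(k < n.+1) f k (n - k)%N)) => //.
- near=> N; rewrite !triangle_sum; apply/andP; split.
    by apply: ler_sum => k _; apply: le_sum_widen => //; rewrite leq_subr.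
  apply: (@le_trans _ _ (\sum_(k < N) \sum_(j < (N + N - k)%N) f k j)).
    apply: ler_sum => k _; apply: le_sum_widen => //.
    by rewrite -addnBA ?leq_addr// ltnW.
  apply: (@le_sum_widen (fun k => \sum_(j < (N + N - k)%N) f k j)).
    by rewrite leq_addr.
  by move=> i; apply: sumr_ge0.
- have NN : (fun N => (N + N)%N) @ \oo --> \oo.
    move=> A [N _ NA]; exists N => // n /= Nn; apply: NA => /=.
    by rewrite (leq_trans Nn)// leq_addr.
  exact: (cvg_comp _ _ NN fl).
Unshelve. all: by end_near. Qed.

End power_series.

(** * Wild sums *)

(** The bounds hold at every point, not almost everywhere, so that the Wild construction can be
    carried out for each [x] separately. Null sets are dealt with afterwards. *)
Definition box {R : realType} {d} {E : measurableType d} (C : R) (u : E -> R) :=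
  measurable_fun setT u /\ forall x, 0 <= u x <= C.

Section wild_sum.
Context (R : realType) d (E : measurableType d).
Variables (C h M B : R) (T : (E -> R) -> (E -> R) -> E -> R).
Implicit Types (u v w : E -> R) (a e r t : R).

Local Notation bnn u := (exists b, box b u).

Hypothesis h_gt0 : 0 < h.
(** Linearity is asked for only on the cone of bounded nonnegative functions, with nonnegative
    coefficients: there the gain and loss integrals have nonnegative integrands. *)
Hypothesis T_lin1 : forall a u v w, 0 <= a -> bnn u -> bnn v -> bnn w ->
  forall x, T (fun y => a * u y + v y) w x = a * T u w x + T v w x.
Hypothesis T_lin2 : forall a u v w, 0 <= a -> bnn u -> bnn v -> bnn w ->
  forall x, T w (fun y => a * u y + v y) x = a * T w u x + T w v x.
Hypothesis T_meas : forall u v, bnn u -> bnn v -> measurable_fun setT (T u v).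
Hypothesis T_box : forall u v, box C u -> box C v ->
  forall x, 0 <= u x + h * T v u x <= C.
Hypothesis T_lip : forall u v e, box C u -> box C v ->
  (forall x, `|u x - v x| <= e) -> forall x, `|T u u x - T v v x| <= M * e.
Hypothesis T_bnd : forall u, box C u -> forall x, `|T u u x| <= B.

Lemma bnn0 : bnn (fun _ : E => 0 : R).
Proof. by exists 0; split=> [|x]; [exact: measurable_cst|rewrite lexx]. Qed.

Lemma bnn_lin a u v : 0 <= a -> bnn u -> bnn v -> bnn (fun x => a * u x + v x).
Proof.
move=> a0 [b [mu ub]] [b' [mv vb]]; exists (a * b + b'); split.
  by apply: measurable_funD => //; apply: measurable_funM => //.
move=> x; have /andP[u0 u1] := ub x; have /andP[v0 v1] := vb x.
by rewrite addr_ge0 ?mulr_ge0// lerD// ler_wpM2l.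
Qed.

Let sum0f (F : nat -> E -> R) : (fun x => \sum_(k < 0) F k x) = fun _ => 0.
Proof. by apply/funext => x; rewrite big_ord0. Qed.

Let sumSf (F : nat -> E -> R) n :
  (fun x => \sum_(k < n.+1) F k x) = fun x => F n x + \sum_(k < n) F k x.
Proof. by apply/funext => x; rewrite big_ord_recr addrC. Qed.

Lemma bnn_sum (c : nat -> R) (f : nat -> E -> R) n :
  (forall k, 0 <= c k) -> (forall k, bnn (f k)) ->
  bnn (fun x => \sum_(k < n) c k * f k x).
Proof.
move=> c0 f0; elim: n => [|n IH].
  by rewrite (sum0f (fun k x => c k * f k x)); exact: bnn0.
by rewrite (sumSf (fun k x => c k * f k x)); exact: bnn_lin.
Qed.

(** Additivity at [0 = 1 * 0 + 0] makes the value equal to its double. *)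
Lemma T0l w : bnn w -> forall x, T (fun _ => 0) w x = 0.
Proof.
move=> w0 x; have := @T_lin1 1 _ _ _ ler01 bnn0 bnn0 w0 x.
rewrite (_ : (fun y => _) = fun _ => 0); last first.
  by apply/funext => y; rewrite mulr0 addr0.
by rewrite mul1r; lra.
Qed.

Lemma T0r w : bnn w -> forall x, T w (fun _ => 0) x = 0.
Proof.
move=> w0 x; have := @T_lin2 1 _ _ _ ler01 bnn0 bnn0 w0 x.
rewrite (_ : (fun y => _) = fun _ => 0); last first.
  by apply/funext => y; rewrite mulr0 addr0.
by rewrite mul1r; lra.
Qed.

Lemma T_suml (c : nat -> R) (f : nat -> E -> R) n w x :
  (forall k, 0 <= c k) -> (forall k, bnn (f k)) -> bnn w ->
  T (fun y => \sum_(k < n) c k * f k y) w x = \sum_(k < n) c k * T (f k) w x.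
Proof.
move=> c0 f0 w0; elim: n => [|n IH].
  by rewrite (sum0f (fun k x => c k * f k x)) T0l// big_ord0.
rewrite (sumSf (fun k x => c k * f k x)).
by rewrite T_lin1 ?IH 1?big_ord_recr 1?addrC//; exact: bnn_sum.
Qed.

Lemma T_sumr (c : nat -> R) (f : nat -> E -> R) n w x :
  (forall k, 0 <= c k) -> (forall k, bnn (f k)) -> bnn w ->
  T w (fun y => \sum_(k < n) c k * f k y) x = \sum_(k < n) c k * T w (f k) x.
Proof.
move=> c0 f0 w0; elim: n => [|n IH].
  by rewrite (sum0f (fun k x => c k * f k x)) T0r// big_ord0.
rewrite (sumSf (fun k x => c k * f k x)).
by rewrite T_lin2 ?IH 1?big_ord_recr 1?addrC//; exact: bnn_sum.
Qed.

Lemma box_step u v : box C u -> box C v -> box C (fun x => u x + h * T v u x).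
Proof.
move=> bu bv; split; last exact: T_box.
apply: measurable_funD; first by case: bu.
by apply: measurable_funM => //; apply: T_meas; exists C.
Qed.

Variable p0 : E -> R.
Hypothesis p0_box : box C p0.

(** By the recursion [q n.+1] is the average of [n + 1] functions [S(q (n - k), q k)], each of which
    stays in the box by [T_box]; hence so does [q n.+1]. *)
Lemma wild_coefs : exists q : nat -> E -> R, [/\ q 0%N = p0,
  forall n, box C (q n) &
  forall n x, n.+1%:R * q n.+1 x =
    \sum_(k < n.+1) (q k x + h * T (q (n - k)%N) (q k) x)].
Proof.
have [|q [q0 qS]] := @history_recursion (E -> R) p0 (fun n f => fun x =>
    n.+1%:R^-1 * \sum_(k < n.+1) (f k x + h * T (f (n - k)%N) (f k) x)).
  move=> n f g fg; apply/funext => x; congr (_ * _); apply: eq_bigr => k _.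
  by rewrite !fg ?leq_subr// -ltnS.
have qn n x : n.+1%:R * q n.+1 x =
    \sum_(k < n.+1) (q k x + h * T (q (n - k)%N) (q k) x).
  by rewrite qS mulVKf.
exists q; split => //.
elim/ltn_ind => -[|n] IH; first by rewrite q0.
have st (k : 'I_n.+1) : box C (fun x => q k x + h * T (q (n - k)%N) (q k) x).
  by apply: box_step; apply: IH => //; rewrite ltnS leq_subr.
split.
  rewrite qS; apply: measurable_funM => //.
  by apply: measurable_sum => k; case: (st k).
move=> x; have n0 : 0 < n.+1%:R :> R by rewrite ltr0n.
apply/andP; split.
  rewrite -(pmulr_rge0 _ n0) qn.
  by apply: sumr_ge0 => k _; have [_ /(_ x)/andP[]] := st k.
rewrite -(ler_pM2l n0) qn mulr_natl -[X in _ *+ X]card_ord -sumr_const.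
apply: ler_sum => k _.
by have [_ /(_ x)/andP[]] := st k.
Qed.

Section sum_of_wild.
Variable q : nat -> E -> R.
Hypothesis q_init : q 0%N = p0.
Hypothesis q_box : forall n, box C (q n).
Hypothesis q_rec : forall n x, n.+1%:R * q n.+1 x =
  \sum_(k < n.+1) (q k x + h * T (q (n - k)%N) (q k) x).

Let q_bnn n : bnn (q n). Proof. by exists C. Qed.

Let q_subexp x : subexp (fun n => q n x).
Proof.
apply: (@bounded_subexp _ _ C) => n.
by have [_ /(_ x)/andP[q0 qC]] := q_box n; rewrite ger0_norm.
Qed.

(** The weights [(1 - r) * r ^+ k] are those of a geometric distribution; with [r = 1 - e^(-t/h)]
    this is the Wild sum at time [t], cut off after [N] terms. *)
Let psum r N x := \sum_(k < N) ((1 - r) * r ^+ k) * q k x.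
Let psumE r N x : psum r N x = (1 - r) * pseries (fun n => q n x) r N.
Proof.
rewrite /psum /pseries /series/= big_mkord mulr_sumr.
by apply: eq_bigr => k _; rewrite -mulrA [r ^+ _ * _]mulrC.
Qed.

Let wild r x := (1 - r) * limn (pseries (fun n => q n x) r).

Section fixed_radius.
Variable r : R.
Hypothesis r01 : 0 <= r < 1.

Let r_ge0 : 0 <= r. Proof. by case/andP: r01. Qed.
Let r1_ge0 : 0 <= 1 - r. Proof. by case/andP: r01 => _ /ltW; rewrite subr_ge0. Qed.
Let norm_r : `|r| < 1. Proof. by rewrite ger0_norm//; case/andP: r01. Qed.

Let psum_cvg x : psum r ^~ x @ \oo --> wild r x.
Proof.
under eq_fun do rewrite psumE.
by apply: cvgMr; apply: subexp_cvg.
Qed.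

Let geo_cvg0 a : a * r ^+ n @[n --> \oo] --> 0.
Proof. exact: cvg_geometric. Qed.

Let psum_le x N : psum r N x <= wild r x.
Proof.
rewrite -(cvg_lim _ (@psum_cvg x))//.
apply: (@nondecreasing_cvgn_le _ (psum r ^~ x)); last first.
  by apply/cvg_ex; eexists; exact: psum_cvg.
apply/nondecreasing_seqP => n; rewrite /psum big_ord_recr/= lerDl.
by have [_ /(_ x)/andP[q0 _]] := q_box n; rewrite !mulr_ge0 ?exprn_ge0.
Qed.

(** The omitted weights add up to [r ^+ N] and each [q n] is at most [C]; thus [psum] plus
    [C * r ^+ N] decreases to the full sum. The resulting error bound is uniform in [x]. *)
Let psum_ge x N : wild r x <= psum r N x + C * r ^+ N.
Proof.
have cv : (fun n => psum r n x + C * r ^+ n) @ \oo --> wild r x.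
  by rewrite -[wild r x]addr0; apply: cvgD.
rewrite -(cvg_lim _ cv)//.
apply: (@nonincreasing_cvgn_ge _ (fun n => psum r n x + C * r ^+ n)); last first.
  by apply/cvg_ex; eexists; exact: cv.
apply/nonincreasing_seqP => n; rewrite /psum big_ord_recr/= exprS.
have [_ /(_ x)/andP[q0 qC]] := q_box n.
have := ler_wpM2l (mulr_ge0 r1_ge0 (exprn_ge0 n r_ge0)) qC.
lra.
Qed.

Let wild_box : box C (wild r).
Proof.
split.
  apply: (@measurable_fun_cvg _ _ _ _ (psum r)) => [N|x _]; last exact: psum_cvg.
  by apply: measurable_sum => k; apply: measurable_funM => //; case: (q_box k).
move=> x; have := psum_le x 0; have := psum_ge x 0.
by rewrite /psum big_ord0 expr0 add0r mulr1 => -> ->.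
Qed.

Let psum_box N : box C (psum r N).
Proof.
split.
  by apply: measurable_sum => k; apply: measurable_funM => //; case: (q_box k).
move=> x; apply/andP; split.
  apply: sumr_ge0 => k _; have [_ /(_ x)/andP[q0 _]] := q_box k.
  by rewrite !mulr_ge0 ?exprn_ge0.
by rewrite (le_trans (psum_le x N))//; have [_ /(_ x)/andP[]] := wild_box.
Qed.

Let geo_sum N : \sum_(k < N) (1 - r) * r ^+ k = 1 - r ^+ N.
Proof.
elim: N => [|N IH]; first by rewrite big_ord0 expr0 subrr.
by rewrite big_ord_recr/= IH exprS; ring.
Qed.

(** Multiplied by [(1 - r)^2 r^n] and summed over [n], the recursion has the differentiated series
    on the left, and on the right the array [f] summed by antidiagonals. Summed over squares
    instead, [f] factors by bilinearity, and [cauchy_product_cvg] identifies the two limits. *)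
Lemma wild_equation x :
  (1 - r) ^+ 2 * limn (pseries (pseries_diffs (fun n => q n x)) r) =
  wild r x + h * T (wild r) (wild r) x.
Proof.
pose c k := (1 - r) * r ^+ k.
have c0 k : 0 <= c k by rewrite mulr_ge0// exprn_ge0.
pose f k l := c k * c l * (q k x + h * T (q l) (q k) x).
apply: (@cauchy_product_cvg _ f).
- move=> i j; have /andP[S0 _] := T_box (q_box i) (q_box j) x.
  by apply: mulr_ge0 => //; exact: mulr_ge0.
- rewrite (_ : (fun N => _) = fun N =>
      (1 - r) ^+ 2 * pseries (pseries_diffs (fun n => q n x)) r N).
    by apply: cvgMr; exact/subexp_cvg/norm_r/subexp_diffs.
  apply/funext => N; rewrite /pseries /series/= big_mkord mulr_sumr.
  apply: eq_bigr => n _; rewrite /pseries_diffs q_rec mulr_suml mulr_sumr.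
  apply: eq_bigr => k _; rewrite /f /c -[in r ^+ n](@subnKC k n) -1?ltnS// exprD.
  by ring.
(* In the term [q k x] of [S] the index [l] is free, so its weights sum to [1 - r ^+ N]; the other
   term is [T] at the truncated sum. *)
- rewrite (_ : (fun N => _) = fun N => psum r N x * (1 - r ^+ N) +
      h * T (psum r N) (psum r N) x).
    rewrite -[X in X + _]mulr1; apply: cvgD; last first.
      (* The truncated and full sums differ by at most [C * r ^+ N] at every point, so [T_lip] gives
         the convergence of the values of [T]. *)
      apply: cvgMr; apply/cvgrPdist_le => /= e e0.
      have := geo_cvg0 (M * C) => /cvgrPdist_le/(_ _ e0).
      apply: filterS => N; rewrite sub0r normrN => HN.
      apply: (@le_trans _ _ (M * (C * r ^+ N))).
        apply: T_lip => // y; rewrite ger0_norm ?subr_ge0//.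
        by rewrite lerBlDl.
      by rewrite mulrA (le_trans _ HN)// ler_norm.
    apply: cvgM; first exact: psum_cvg.
    rewrite -[X in _ --> X]subr0; apply: cvgB; first exact: cvg_cst.
    exact: cvg_expr.
  apply/funext => N; rewrite /f.
  have -> : T (psum r N) (psum r N) x =
      \sum_(k < N) \sum_(l < N) c k * c l * T (q l) (q k) x.
    have bN : bnn (psum r N) by exists C.
    rewrite (@T_sumr c q N (psum r N) x)//.
    apply: eq_bigr => k _; rewrite (@T_suml c q N (q k) x)// mulr_sumr.
    by apply: eq_bigr => l _; rewrite mulrA.
  rewrite -geo_sum /psum mulr_suml mulr_sumr -big_split/=.
  apply: eq_bigr => k _; rewrite !mulr_sumr -big_split/=.
  by apply: eq_bigr => l _; rewrite /c; ring.
Qed.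

Lemma box_wild : box C (wild r). Proof. exact: wild_box. Qed.

End fixed_radius.

Lemma wild0 : wild 0 = p0.
Proof.
apply/funext => x; rewrite /wild subr0 mul1r -q_init.
(* The shift skips the empty partial sum, which is 0; all later ones equal [q 0 x], because
   [0 ^+ 0 = 1]. *)
apply: cvg_lim => //; rewrite -(cvg_shiftS _) /=.
have e n : pseries (fun n => q n x) 0 n.+1 = q 0%N x; last first.
  by under eq_fun do rewrite e; exact: cvg_cst.
rewrite /pseries /series/= big_nat_recl// expr0 mulr1 big1.
  by rewrite addr0.
by move=> i _; rewrite exprS mul0r mulr0.
Qed.

Let rad t := 1 - expR (- t / h).

Let rad01 t : 0 <= t -> 0 <= rad t < 1.
Proof.
move=> t0; rewrite subr_ge0 gtrBl expR_gt0 andbT.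
by rewrite -expR0 ler_expR mulNr oppr_le0 divr_ge0// ltW.
Qed.

(** With [r = rad t] one has [r' = (1 - r) / h]. For the power series [F] with coefficients [q n x],
    the product rule applied to [(1 - r) F(r)] gives [((1 - r)^2 F'(r) - (1 - r) F(r)) / h], which
    [wild_equation] identifies with [T]. *)
Lemma is_derive_wild x t : 0 <= t ->
  is_derive t 1 (fun s => wild (rad s) x) (T (wild (rad t)) (wild (rad t)) x).
Proof.
move=> t0; have rt := rad01 t0.
have nr : `|rad t| < 1 by rewrite ger0_norm; case/andP: rt.
have de : is_derive t 1 (fun s => expR (- s / h)) (- h^-1 * expR (- t / h)).
  have dl : is_derive t 1 (fun s : R => - s / h) (- h^-1).
    rewrite (_ : (fun s => _) = - h^-1 *: id); last first.
      by apply/funext => s; rewrite /= mulNr mulrC -mulNr.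
    by apply: is_derive_eq; rewrite [_ *: _]mulr1.
  by rewrite [- _ * _]mulrC; exact: is_derive1_comp.
have dr : is_derive t 1 rad (h^-1 * expR (- t / h)).
  rewrite (_ : rad = cst 1 - (fun s => expR (- s / h))) //.
  by apply: is_derive_eq; rewrite sub0r mulNr opprK.
have dF := is_derive1_comp (is_derive_pseries (q_subexp x) nr) dr.
rewrite (_ : (fun s => wild (rad s) x) = (fun s => expR (- s / h)) *
   ((fun y => limn (pseries (fun n => q n x) y)) \o rad)); last first.
  by apply/funext => s; rewrite /wild /rad subKr.
apply: is_derive_eq.
have rE : 1 - rad t = expR (- t / h) by rewrite /rad subKr.
have := wild_equation rt x; set TT := T _ _ _.
rewrite {1}/wild rE => eqT; have {eqT} -> : TT = h^-1 * (expR (- t / h) ^+ 2 *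
    limn (pseries (pseries_diffs (fun n => q n x)) (rad t)) -
    expR (- t / h) * limn (pseries (fun n => q n x) (rad t))).
  by rewrite eqT addrAC subrr add0r mulKf// gt_eqF.
by rewrite /GRing.scale/=; ring.
Qed.

End sum_of_wild.

(** A derivative in [L^oo] needs an estimate uniform in [x]. By the mean value theorem the quotient
    is the value of [T] at an intermediate time [c], which may depend on [x]; [B] is a Lipschitz
    constant of [p] in time and [M] one of [T], whence the error [M * (B * |s - t|)]. *)
Theorem wild_solution : exists p : R -> E -> R,
  [/\ p 0 = p0, (forall t, 0 <= t -> box C (p t)) &
      forall s t, 0 <= s -> 0 <= t -> s != t -> forall x,
        `|(p s x - p t x) / (s - t) - T (p t) (p t) x| <= M * (B * `|s - t|)].
Proof.
have [q [q0 qC qS]] := wild_coefs.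
(* Left unsimplified, to agree by conversion with the Wild sum at radius [1 - expR (- t / h)]. *)
pose p t x := (1 - (1 - expR (- t / h))) *
   limn (pseries (fun n => q n x) (1 - expR (- t / h))).
have pbox t : 0 <= t -> box C (p t).
  move=> t0; apply: box_wild => //.
  rewrite subr_ge0 gtrBl expR_gt0 andbT.
  by rewrite -expR0 ler_expR mulNr oppr_le0 divr_ge0// ltW.
have dp x t : 0 <= t -> is_derive t 1 (p ^~ x) (T (p t) (p t) x).
  exact: is_derive_wild.
have mvt x s t : 0 <= s -> 0 <= t -> s < t -> exists2 c, s <= c <= t &
    p t x - p s x = T (p c) (p c) x * (t - s).
  move=> s0 t0 st.
  have [||c] := @MVT _ (p ^~ x) (fun c => T (p c) (p c) x) s t st.
  - by move=> y /[!in_itv]/= /andP[sy _]; apply: dp; rewrite (le_trans s0)// ltW.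
  - apply: derivable_within_continuous => y /[!in_itv]/= /andP[sy _].
    by case: (dp x y (le_trans s0 sy)).
  - move=> /[!in_itv]/= /andP[sc ct] e; exists c => //.
    by rewrite !ltW.
have quot x s t : 0 <= s -> 0 <= t -> s != t -> exists c,
    [/\ 0 <= c, `|c - t| <= `|s - t| & (p s x - p t x) / (s - t) = T (p c) (p c) x].
  move=> s0 t0; case: ltgtP => // st _.
    have [c /andP[sc ct] e] := mvt x _ _ s0 t0 st; exists c; split.
    - exact: le_trans sc.
    - by rewrite ler0_norm ?ler0_norm ?subr_le0 ?(ltW st)// lerN2 lerB.
    - by rewrite -opprB e -mulrN opprB mulfK// subr_eq0 lt_eqF.
  have [c /andP[sc ct] e] := mvt x _ _ t0 s0 st; exists c; split.
  - exact: le_trans sc.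
  - by rewrite ger0_norm ?ger0_norm ?subr_ge0 ?(ltW st)// lerB.
  - by rewrite e mulfK// subr_eq0 gt_eqF.
have plip s t x : 0 <= s -> 0 <= t -> `|p s x - p t x| <= B * `|s - t|.
  move=> s0 t0; have [->|st] := eqVneq s t; first by rewrite !subrr normr0 mulr0.
  have [c [c0 _ e]] := quot x _ _ s0 t0 st.
  have -> : p s x - p t x = T (p c) (p c) x * (s - t).
    by rewrite -e divfK// subr_eq0.
  by rewrite normrM ler_wpM2r// T_bnd//; exact: pbox.
exists p; split => //.
  rewrite -(wild0 q0); apply/funext => x.
  by rewrite /p oppr0 mul0r expR0 subrr oppr0.
move=> s t s0 t0 st x; have [c [c0 cst ->]] := quot x _ _ s0 t0 st.
apply: T_lip => [||y]; try exact: pbox.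
rewrite (le_trans (plip _ _ _ c0 t0))// ler_wpM2l//.
by rewrite (le_trans _ (T_bnd p0_box x)).
Qed.

End wild_sum.

(** * The gain and loss operators *)

Section weighted_integral.
Local Open Scope ereal_scope.
Context d (E : measurableType d) (R : realType) (nu : {measure set E -> \bar R}).
Variable k : E -> \bar R.
Hypotheses (mk : measurable_fun setT k) (k0 : forall x, 0 <= k x).
Implicit Types u v : E -> R.

Definition wint u := \int[nu]_x (k x * (u x)%:E).

Lemma measurable_wint_integrand u : measurable_fun setT u ->
  measurable_fun setT (fun x => k x * (u x)%:E).
Proof. by move=> mu; apply: emeasurable_funM => //; exact/measurable_EFinP. Qed.

Lemma wint_integrand_ge0 u x : (forall x, 0 <= u x)%R -> 0 <= k x * (u x)%:E.
Proof. by move=> u0; rewrite mule_ge0// lee_fin. Qed.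

Lemma wint_ge0 u : (forall x, 0 <= u x)%R -> 0 <= wint u.
Proof. by move=> u0; apply: integral_ge0 => x _; exact: wint_integrand_ge0. Qed.

Lemma wint_lin (a : R) u v : (0 <= a)%R ->
  measurable_fun setT u -> (forall x, 0 <= u x)%R ->
  measurable_fun setT v -> (forall x, 0 <= v x)%R ->
  wint (fun x => a * u x + v x)%R = a%:E * wint u + wint v.
Proof.
move=> a0 mu u0 mv v0; rewrite /wint.
rewrite -ge0_integralZl ?lee_fin//; last 2 first.
  exact: measurable_wint_integrand.
  by move=> x _; exact: wint_integrand_ge0.
rewrite -ge0_integralD//.
- apply: eq_integral => x _.
  by rewrite EFinD ge0_muleDr ?lee_fin ?mulr_ge0// EFinM muleCA.
- by move=> x _; rewrite mule_ge0 ?lee_fin ?wint_integrand_ge0.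
- by apply: emeasurable_funM => //; exact: measurable_wint_integrand.
- by move=> x _; exact: wint_integrand_ge0.
- exact: measurable_wint_integrand.
Qed.

Lemma le_wint u v : measurable_fun setT u -> (forall x, 0 <= u x)%R ->
  measurable_fun setT v -> (forall x, u x <= v x)%R -> wint u <= wint v.
Proof.
move=> mu u0 mv uv; apply: ge0_le_integral => //.
- by move=> x _; exact: wint_integrand_ge0.
- exact: measurable_wint_integrand.
- exact: measurable_wint_integrand.
- by move=> x _; rewrite lee_wpmul2l// lee_fin.
Qed.

Lemma wint_le_bound (b K : R) u : (0 <= b)%R -> \int[nu]_x k x <= K%:E ->
  box b u -> wint u <= (b * K)%:E.
Proof.
move=> b0 kK [mu ub]; have u0 x : (0 <= u x)%R by have /andP[] := ub x.
apply: (@le_trans _ _ (wint (cst b))).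
  by apply: le_wint => // x; have /andP[] := ub x.
rewrite /wint; under eq_integral do rewrite muleC /cst.
by rewrite ge0_integralZl ?lee_fin// EFinM lee_wpmul2l.
Qed.

End weighted_integral.

Section kinetic_operator.
Context d (E : measurableType d) (R : realType).
Variable mu : {sigma_finite_measure set E -> \bar R}.
Variables (k : E -> E -> E -> \bar R) (a : E -> E -> \bar R) (K C : R).
Implicit Types (u v w : E -> R) (c e b : R).

(** For [k := ctilde c] and [a := a1 c] this is [kinetic_rhs c] by conversion. *)
Definition kinetic u x : \bar R := (
  \int[mu]_y1 \int[mu]_y2 (k y1 y2 x * (u y1)%:E * (u y2)%:E)
  - (u x)%:E * \int[mu]_y (a x y * (u y)%:E))%E.

Hypotheses (K_gt0 : 0 < K) (C_gt0 : 0 < C).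
Hypotheses (mk : measurable_fun setT (fun z : E * E * E => k z.1.1 z.1.2 z.2))
  (k_ge0 : forall y1 y2 x, (0 <= k y1 y2 x)%E).
Hypotheses (ma : measurable_fun setT (fun z : E * E => a z.1 z.2))
  (a_ge0 : forall x y, (0 <= a x y)%E).
Hypothesis k_le : forall x,
  (\int[mu]_y1 \int[mu]_y2 k y1 y2 x <= K%:E)%E.
Hypothesis a_le : forall x, (\int[mu]_y a x y <= K%:E)%E.
Hypothesis k_le_a : forall x,
  {ae mu, forall y, (\int[mu]_y2 k y y2 x <= a x y)%E}.

Let mk_x x : measurable_fun setT (fun z : E * E => k z.1 z.2 x).
Proof. exact: (measurableT_comp mk (measurable_pair2 x)). Qed.

Let ma_x x : measurable_fun setT (a x).
Proof. exact: (measurableT_comp ma (measurable_pair1 x)). Qed.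

(** A single integral against the product measure, so that the facts on [wint] apply to gain and
    loss alike. Taking [fine] loses nothing on bounded nonnegative functions, where [gainE] and
    [lossE] show finiteness. *)
Definition gain u v x := fine (wint (mu \x mu)%E (fun z => k z.1 z.2 x)
  (fun z => u z.1 * v z.2)).
Definition loss u x := fine (wint mu (a x) u).

Let m_tensor u v : measurable_fun setT u -> measurable_fun setT v ->
  measurable_fun setT (fun z : E * E => u z.1 * v z.2).
Proof.
by move=> mu_ mv; apply: measurable_funM; exact: measurableT_comp.
Qed.

Let box_tensor b b' u v : box b u -> box b' v ->
  box (b * b') (fun z : E * E => u z.1 * v z.2).
Proof.
move=> [mu_ ub] [mv vb]; split; first exact: m_tensor.
move=> [x y] /=; have /andP[u0 u1] := ub x; have /andP[v0 v1] := vb y.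
by rewrite mulr_ge0//= ler_pM.
Qed.

Let gain_iter u v x : measurable_fun setT u -> measurable_fun setT v ->
  (forall y, 0 <= u y) -> (forall y, 0 <= v y) ->
  (wint (mu \x mu) (fun z => k z.1 z.2 x) (fun z => u z.1 * v z.2)%R =
   \int[mu]_y1 \int[mu]_y2 (k y1 y2 x * (u y1)%:E * (v y2)%:E))%E.
Proof.
move=> mu_ mv u0 v0; rewrite /wint fubini_tonelli1; last 2 first.
  by apply: measurable_wint_integrand => //; exact: m_tensor.
  by move=> z; rewrite mule_ge0 ?lee_fin ?mulr_ge0.
apply: eq_integral => y1 _; rewrite /fubini_F/=.
by apply: eq_integral => y2 _; rewrite EFinM muleA.
Qed.

Let k_le2 x : (\int[mu \x mu]_z k z.1 z.2 x <= K%:E)%E.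
Proof. by rewrite fubini_tonelli1//; exact: k_le. Qed.

Lemma gainE b b' u v x : 0 <= b -> 0 <= b' -> box b u -> box b' v ->
  ((gain u v x)%:E =
   \int[mu]_y1 \int[mu]_y2 (k y1 y2 x * (u y1)%:E * (v y2)%:E))%E /\
  0 <= gain u v x <= b * b' * K.
Proof.
move=> b0 b'0 bu bv; have bt := box_tensor bu bv.
have [[mu_ ub] [mv vb]] := (bu, bv).
have u0 y : 0 <= u y by have /andP[] := ub y.
have v0 y : 0 <= v y by have /andP[] := vb y.
have t0 (z : E * E) : 0 <= u z.1 * v z.2 by rewrite mulr_ge0.
have w0 := wint_ge0 (mu \x mu)%E (fun z => k_ge0 z.1 z.2 x) t0.
have w1 := wint_le_bound (mk_x x) (fun z => k_ge0 z.1 z.2 x)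
  (mulr_ge0 b0 b'0) (k_le2 x) bt.
have fin : wint (mu \x mu)%E (fun z => k z.1 z.2 x)
    (fun z => u z.1 * v z.2) \is a fin_num.
  by rewrite ge0_fin_numE// (le_lt_trans w1)// ltry.
by rewrite -gain_iter// /gain fineK// -!lee_fin fineK// w0 w1.
Qed.

Lemma lossE b u x : 0 <= b -> box b u ->
  ((loss u x)%:E = \int[mu]_y (a x y * (u y)%:E))%E /\ 0 <= loss u x <= b * K.
Proof.
move=> b0 bu; have [mu_ ub] := bu.
have u0 y : 0 <= u y by have /andP[] := ub y.
have w0 := wint_ge0 mu (a_ge0 x) u0.
have w1 := wint_le_bound (ma_x x) (a_ge0 x) b0 (a_le x) bu.
have fin : wint mu (a x) u \is a fin_num.
  by rewrite ge0_fin_numE// (le_lt_trans w1)// ltry.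
by rewrite /loss -!lee_fin fineK// w0 w1.
Qed.

Local Notation bnn u := (exists b, box b u).

Let bnnP u : bnn u -> exists2 b, 0 <= b & box b u.
Proof.
move=> [b [mu_ ub]]; exists `|b| => //; split => // x.
by have /andP[-> ux] := ub x; rewrite (le_trans ux)// ler_norm.
Qed.

Let gain_wint u v x : bnn u -> bnn v ->
  ((gain u v x)%:E = wint (mu \x mu) (fun z => k z.1 z.2 x)
    (fun z => u z.1 * v z.2)%R)%E.
Proof.
move=> /bnnP[b b0 bu] /bnnP[b' b'0 bv]; have [-> _] := gainE x b0 b'0 bu bv.
have [[mu_ ub] [mv vb]] := (bu, bv).
by rewrite gain_iter// => y; [have /andP[] := ub y|have /andP[] := vb y].
Qed.

Let loss_wint u x : bnn u -> ((loss u x)%:E = wint mu (a x) u)%E.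
Proof. by move=> /bnnP[b b0 bu]; have [-> _] := lossE x b0 bu. Qed.

Let tensor_ge0 u v (z : E * E) : bnn u -> bnn v -> 0 <= u z.1 * v z.2.
Proof.
move=> [b [_ ub]] [b' [_ vb]]; rewrite mulr_ge0//.
  by have /andP[] := ub z.1.
by have /andP[] := vb z.2.
Qed.

Let bnn_measurable u : bnn u -> measurable_fun setT u.
Proof. by move=> [b []]. Qed.

Let bnn_ge0 u : bnn u -> forall x, 0 <= u x.
Proof. by move=> [b [_ ub]] x; have /andP[] := ub x. Qed.

Lemma gain_lin1 c u v w : 0 <= c -> bnn u -> bnn v -> bnn w ->
  forall x, gain (fun y => c * u y + v y) w x = c * gain u w x + gain v w x.
Proof.
move=> c0 bu bv bw x; have buv := bnn_lin c0 bu bv.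
apply: EFin_inj; rewrite EFinD EFinM !gain_wint// -wint_lin//.
- by congr wint; apply/funext => z; rewrite mulrDl mulrA.
- by apply: m_tensor; exact: bnn_measurable.
- by move=> z; exact: tensor_ge0.
- by apply: m_tensor; exact: bnn_measurable.
- by move=> z; exact: tensor_ge0.
Qed.

Lemma gain_lin2 c u v w : 0 <= c -> bnn u -> bnn v -> bnn w ->
  forall x, gain w (fun y => c * u y + v y) x = c * gain w u x + gain w v x.
Proof.
move=> c0 bu bv bw x; have buv := bnn_lin c0 bu bv.
apply: EFin_inj; rewrite EFinD EFinM !gain_wint// -wint_lin//.
- by congr wint; apply/funext => z; rewrite mulrDr mulrCA.
- by apply: m_tensor; exact: bnn_measurable.
- by move=> z; exact: tensor_ge0.
- by apply: m_tensor; exact: bnn_measurable.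
- by move=> z; exact: tensor_ge0.
Qed.

Lemma loss_lin c u v : 0 <= c -> bnn u -> bnn v ->
  forall x, loss (fun y => c * u y + v y) x = c * loss u x + loss v x.
Proof.
move=> c0 bu bv x; have buv := bnn_lin c0 bu bv.
apply: EFin_inj; rewrite EFinD EFinM !loss_wint// -wint_lin//.
- exact: bnn_measurable.
- exact: bnn_ge0.
- exact: bnn_measurable.
- exact: bnn_ge0.
Qed.

Lemma le_gain u u' v v' x : bnn u -> bnn u' -> bnn v -> bnn v' ->
  (forall y, u y <= u' y) -> (forall y, v y <= v' y) ->
  gain u v x <= gain u' v' x.
Proof.
move=> bu bu' bv bv' uu' vv'; rewrite -lee_fin !gain_wint//.
apply: le_wint => //.
- by apply: m_tensor; exact: bnn_measurable.
- by move=> z; exact: tensor_ge0.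
- by apply: m_tensor; exact: bnn_measurable.
- by move=> z; rewrite ler_pM ?bnn_ge0.
Qed.

Lemma le_loss u v x : bnn u -> bnn v -> (forall y, u y <= v y) ->
  loss u x <= loss v x.
Proof.
move=> bu bv uv; rewrite -lee_fin !loss_wint//.
by apply: le_wint => //; [exact: bnn_measurable|exact: bnn_ge0|
  exact: bnn_measurable].
Qed.

Lemma measurable_gain u v : bnn u -> bnn v -> measurable_fun setT (gain u v).
Proof.
move=> bu bv; have [u0 v0] := (bnn_ge0 bu, bnn_ge0 bv).
have [mu_ mv] := (bnn_measurable bu, bnn_measurable bv).
rewrite (_ : gain u v = fun x => fine
  (\int[mu]_y1 \int[mu]_y2 (k y1 y2 x * (u y1)%:E * (v y2)%:E))%E); last first.
  by apply/funext => x; rewrite /gain gain_iter.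
apply: (measurableT_comp (f := fine)) => //.
have m1 : measurable_fun setT (fun z : (E * E) * E =>
    (k z.1.2 z.2 z.1.1 * (u z.1.2)%:E * (v z.2)%:E)%E).
  apply: emeasurable_funM; last by apply/measurable_EFinP; exact: measurableT_comp.
  apply: emeasurable_funM.
    have mg : measurable_fun setT (fun z : E * E * E => (z.1.2, z.2, z.1.1)).
      by do 2?apply: measurable_fun_pair => //; exact: measurableT_comp.
    exact: (measurableT_comp mk mg).
  apply/measurable_EFinP; apply: (measurableT_comp mu_) => //.
  exact: measurableT_comp.
have m2 := measurable_fun_fubini_tonelli_F (m2 := mu) _ m1 _.
apply: (measurable_fun_fubini_tonelli_F (m2 := mu) (fun z : E * E =>
  \int[mu]_y2 (k z.2 y2 z.1 * (u z.2)%:E * (v y2)%:E))%E).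
  by apply: m2 => z; rewrite !mule_ge0 ?lee_fin.
by move=> z; apply: integral_ge0 => y _; rewrite !mule_ge0 ?lee_fin.
Qed.

Lemma measurable_loss u : bnn u -> measurable_fun setT (loss u).
Proof.
move=> bu; apply: (measurableT_comp (f := fine)) => //.
apply: (measurable_fun_fubini_tonelli_F (m2 := mu) (fun z : E * E =>
  a z.1 z.2 * (u z.2)%:E)%E).
  apply: emeasurable_funM => //; apply/measurable_EFinP.
  by apply: measurableT_comp => //; exact: bnn_measurable.
by move=> z; rewrite mule_ge0 ?lee_fin ?bnn_ge0.
Qed.

(** After [v] is replaced by the constant [C], the inner integral of the gain is that of [k y y2 x]
    over [y2], which [k_le_a] bounds by [a x y]. *)
Lemma gain_le_loss u v x : box C u -> box C v -> gain u v x <= C * loss u x.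
Proof.
move=> bu bv; have C0 := ltW C_gt0.
have [nu nv] : bnn u /\ bnn v by split; exists C.
have u0 := bnn_ge0 nu; have mu_ := bnn_measurable nu.
have b1 : box 1 (cst 1 : E -> R) by split => // y; rewrite /= ler01 lexx.
have bC : box C (cst C : E -> R) by split => // y; rewrite /= C0 lexx.
have nC : bnn (cst C : E -> R) by exists C.
apply: (@le_trans _ _ (gain u (cst C) x)).
  by apply: le_gain => // y; have [_ /(_ y)/andP[]] := bv.
rewrite -lee_fin EFinM; have [-> _] := gainE x C0 C0 bu bC.
have [-> _] := lossE x C0 bu.
have mH : measurable_fun setT (fun y => \int[mu]_y2 k y y2 x)%E.
  exact: (measurable_fun_fubini_tonelli_F (m2 := mu) (fun z => k z.1 z.2 x)).
have H0 y : (0 <= \int[mu]_y2 k y y2 x)%E by exact: integral_ge0.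
rewrite -ge0_integralZl ?lee_fin//; last 2 first.
  exact: measurable_wint_integrand.
  by move=> y _; exact: wint_integrand_ge0.
rewrite (_ : (\int[mu]_y1 _)%E =
    (\int[mu]_y (C%:E * ((\int[mu]_y2 k y y2 x) * (u y)%:E)))%E); last first.
  apply: eq_integral => y _.
  under eq_integral do rewrite -muleA muleC /cst.
  rewrite ge0_integralZl ?mule_ge0 ?lee_fin//; last first.
    exact: (measurableT_comp (mk_x x) (measurable_pair1 y)).
  by rewrite [((u y)%:E * _)%E]muleC -muleA; congr (_ * _)%E; exact: muleC.
apply: ae_ge0_le_integral => //.
- by move=> y _; rewrite !mule_ge0 ?lee_fin.
- apply: emeasurable_funM => //; apply: emeasurable_funM => //.
  exact/measurable_EFinP.
- by move=> y _; rewrite !mule_ge0 ?lee_fin.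
- by apply: emeasurable_funM => //; exact: measurable_wint_integrand.
- apply: filterS (k_le_a x) => y ky _.
  by rewrite lee_wpmul2l ?lee_fin// lee_wpmul2r ?lee_fin.
Qed.

Definition kinetic_form u v x := gain u v x - v x * loss u x.

Let C_ge0 : 0 <= C. Proof. exact: ltW. Qed.
Let K_ge0 : 0 <= K. Proof. exact: ltW. Qed.

Lemma kineticE u x : box C u -> kinetic u x = (kinetic_form u u x)%:E.
Proof.
move=> bu; rewrite /kinetic /kinetic_form EFinB EFinM.
by have [-> _] := gainE x C_ge0 C_ge0 bu bu; have [-> _] := lossE x C_ge0 bu.
Qed.

Lemma kinetic_form_bound u x : box C u -> `|kinetic_form u u x| <= C * C * K.
Proof.
move=> bu; have [_ /andP[g0 g1]] := gainE x C_ge0 C_ge0 bu bu.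
have [_ /andP[l0 l1]] := lossE x C_ge0 bu; have [_ /(_ x)/andP[u0 u1]] := bu.
have := ler_pM u0 l0 u1 l1; have := mulr_ge0 u0 l0.
by rewrite /kinetic_form ler_norml; lra.
Qed.

(** Put [l = h * loss v x] with [h = (C * K)^-1], so that [0 <= l <= 1]. The new value is at least
    [u x * (1 - l)], and by [gain_le_loss] it is below [C] by at least [(C - u x) * (1 - l)]. *)
Lemma kinetic_form_step u v x : box C u -> box C v ->
  0 <= u x + (C * K)^-1 * kinetic_form v u x <= C.
Proof.
move=> bu bv; rewrite /kinetic_form.
have := gain_le_loss x bv bu.
have [_ /andP[g0 _]] := gainE x C_ge0 C_ge0 bv bu.
have [_ /andP[l0 l1]] := lossE x C_ge0 bv; have [_ /(_ x)/andP[u0 u1]] := bu.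
have CK0 : 0 < C * K by rewrite mulr_gt0.
have h0 : 0 < (C * K)^-1 by rewrite invr_gt0.
rewrite -(ler_pM2l h0).
have : 0 <= (C * K)^-1 * gain v u x by rewrite mulr_ge0 ?(ltW h0).
have L0 : 0 <= (C * K)^-1 * loss v x by rewrite mulr_ge0 ?(ltW h0).
have L1 : (C * K)^-1 * loss v x <= 1 by rewrite mulrC ler_pdivrMr// mul1r.
rewrite mulrBr [_ * (C * loss v x)]mulrCA [_ * (u x * _)]mulrCA.
move: L0 L1; set l := (_ * loss v x); set g := (_ * gain v u x) => L0 L1 G0 G1.
have := mulr_ge0 u0 (_ : 0 <= 1 - l); rewrite subr_ge0 => /(_ L1) H1.
have := mulr_ge0 (_ : 0 <= C - u x) (_ : 0 <= 1 - l).
by rewrite !subr_ge0 => /(_ u1 L1) H2; apply/andP; split; lra.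
Qed.

Let b1 : box 1 (cst 1 : E -> R).
Proof. by split => // y; rewrite /= ler01 lexx. Qed.
Let n1 : bnn (cst 1 : E -> R). Proof. by exists 1. Qed.

(** To stay among nonnegative functions, [u - v] is avoided: [u <= e + v] is inserted in one
    argument at a time, by monotonicity. The two extra terms, [e * gain 1 u] and [e * gain v 1], are
    at most [e * C * K] each. *)
Lemma gain_shift u v e x : box C u -> box C v -> (forall y, `|u y - v y| <= e) ->
  gain u u x <= gain v v x + 2 * C * K * e.
Proof.
move=> bu bv uv; have e0 : 0 <= e by exact: le_trans (uv x).
have [nu nv] : bnn u /\ bnn v by split; exists C.
have ue y : u y <= e * cst 1 y + v y.
  by rewrite mulr1 -lerBlDr (le_trans _ (uv y))// ler_norm.
have nev := bnn_lin e0 n1 nv.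
apply: (@le_trans _ _ (gain (fun y => e * cst 1 y + v y) u x)).
  exact: le_gain.
rewrite gain_lin1//.
apply: (@le_trans _ _ (e * gain (cst 1) u x +
    gain v (fun y => e * cst 1 y + v y) x)).
  by rewrite lerD2l; exact: le_gain.
rewrite gain_lin2//.
have [_ /andP[_ h1]] := gainE x ler01 C_ge0 b1 bu.
have [_ /andP[_ h2]] := gainE x C_ge0 ler01 bv b1.
have := ler_wpM2l e0 h1; have := ler_wpM2l e0 h2; lra.
Qed.

Lemma loss_shift u v e x : box C u -> box C v -> (forall y, `|u y - v y| <= e) ->
  loss u x <= loss v x + K * e.
Proof.
move=> bu bv uv; have e0 : 0 <= e by exact: le_trans (uv x).
have [nu nv] : bnn u /\ bnn v by split; exists C.
have nev := bnn_lin e0 n1 nv.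
apply: (@le_trans _ _ (loss (fun y => e * cst 1 y + v y) x)).
  apply: le_loss => // y.
  by rewrite mulr1 -lerBlDr (le_trans _ (uv y))// ler_norm.
rewrite loss_lin//; have [_ /andP[_ h1]] := lossE x ler01 b1.
have := ler_wpM2l e0 h1; lra.
Qed.

(** Of the constant 4, the gain accounts for 2, and each half of the splitting
    [(u - v) L(u) + v (L(u) - L(v))] of the loss for 1. *)
Lemma kinetic_form_lip u v e : box C u -> box C v ->
  (forall y, `|u y - v y| <= e) ->
  forall x, `|kinetic_form u u x - kinetic_form v v x| <= 4 * C * K * e.
Proof.
move=> bu bv uv x; have vu y : `|v y - u y| <= e by rewrite distrC.
have g1 := gain_shift x bu bv uv; have g2 := gain_shift x bv bu vu.
have l1 := loss_shift x bu bv uv; have l2 := loss_shift x bv bu vu.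
have [_ /andP[l0 lC]] := lossE x C_ge0 bu; have [_ /(_ x)/andP[v0 vC]] := bv.
have hl : `|loss u x - loss v x| <= K * e by rewrite ler_norml; lra.
have hg : `|gain u u x - gain v v x| <= 2 * C * K * e.
  by rewrite ler_norml; lra.
have -> : kinetic_form u u x - kinetic_form v v x = gain u u x - gain v v x
    - ((u x - v x) * loss u x + v x * (loss u x - loss v x)).
  by rewrite /kinetic_form; ring.
have h1 : `|(u x - v x) * loss u x| <= e * (C * K).
  by rewrite normrM [`|loss u x|]ger0_norm// ler_pM.
have h2 : `|v x * (loss u x - loss v x)| <= C * (K * e).
  by rewrite normrM [`|v x|]ger0_norm// ler_pM.
apply: le_trans (ler_normB _ _) _.
have := ler_normD ((u x - v x) * loss u x) (v x * (loss u x - loss v x)).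
lra.
Qed.

Lemma kinetic_flow p0 : box C p0 -> exists p : R -> E -> R,
  [/\ p 0 = p0, forall t, 0 <= t -> box C (p t) &
      forall s t, 0 <= s -> 0 <= t -> s != t -> forall x,
        (`|((p s x - p t x) / (s - t))%:E - kinetic (p t) x| <=
         (4 * C * K * (C * C * K * `|s - t|))%:E)%E].
Proof.
move=> bp.
have h0 : 0 < (C * K)^-1 by rewrite invr_gt0 mulr_gt0.
have lin1 c u v w : 0 <= c -> bnn u -> bnn v -> bnn w -> forall x,
    kinetic_form (fun y => c * u y + v y) w x =
    c * kinetic_form u w x + kinetic_form v w x.
  move=> c0 bu bv bw x.
  by rewrite /kinetic_form gain_lin1// loss_lin//; ring.
have lin2 c u v w : 0 <= c -> bnn u -> bnn v -> bnn w -> forall x,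
    kinetic_form w (fun y => c * u y + v y) x =
    c * kinetic_form w u x + kinetic_form w v x.
  by move=> c0 bu bv bw x; rewrite /kinetic_form gain_lin2//; ring.
have meas u v : bnn u -> bnn v -> measurable_fun setT (kinetic_form u v).
  move=> bu bv; apply: measurable_funB; first exact: measurable_gain.
  by apply: measurable_funM; [exact: bnn_measurable|exact: measurable_loss].
have [|p [p0E pC dp]] := wild_solution h0 lin1 lin2 meas _ kinetic_form_lip
    (fun u bu x => kinetic_form_bound x bu) bp.
  by move=> u v bu bv x; exact: kinetic_form_step.
exists p; split => // s t s0 t0 st x.
by rewrite kineticE ?lee_fin; [exact: dp|exact: pC].
Qed.

Lemma kinetic_lip u v e : box C u -> box C v ->
  (forall y, `|u y - v y| <= e) ->
  forall x, (`|kinetic u x - kinetic v x| <= (4 * C * K * e)%:E)%E.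
Proof.
by move=> bu bv uv x; rewrite !kineticE// lee_fin; exact: kinetic_form_lip.
Qed.

Lemma kinetic_bound u x : box C u -> (`|kinetic u x| <= (C * C * K)%:E)%E.
Proof. by move=> bu; rewrite !kineticE// lee_fin; exact: kinetic_form_bound. Qed.

End kinetic_operator.

(** * Gronwall's lemma and null sets of a product *)

Section gronwall.
Context d (E : measurableType d) (R : realType) (mu : {measure set E -> \bar R}).

(** Only the values [1 / (n + 1)] of [e] are used, so that countably many null sets suffice. *)
Lemma ae_le_limit (f : E -> R) (r : R) :
  (forall e, 0 < e -> {ae mu, forall x, f x <= r + e}) ->
  {ae mu, forall x, f x <= r}.
Proof.
move=> H.
have /ae_foralln : forall n : nat, {ae mu, forall x, f x <= r + n.+1%:R^-1}.
  by move=> n; apply: H; rewrite invr_gt0.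
apply: filterS => x fx; apply/ler_addgt0Pr => e e0.
have [n ne] : exists n : nat, n.+1%:R^-1 < e.
  exists (Num.truncn e^-1); rewrite invf_plt ?posrE//.
  exact: truncnS_gt.
by rewrite (le_trans (fx n))// lerD2l ltW.
Qed.

Variables (T M A : R) (w k : R -> E -> R).
Hypothesis M_ge0 : 0 <= M.
Hypothesis w_deriv : forall t e, 0 <= t <= T -> 0 < e -> exists2 r, 0 < r &
  forall s, 0 <= s <= T -> `|s - t| < r ->
    {ae mu, forall x, `|w s x - w t x - (s - t) * k t x| <= e * `|s - t|}.
Hypothesis w_bound : forall t, 0 <= t <= T -> {ae mu, forall x, `|w t x| <= A}.
Hypothesis k_bound : forall t e, 0 <= t <= T ->
  {ae mu, forall x, `|w t x| <= e} -> {ae mu, forall x, `|k t x| <= M * e}.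
Hypothesis w_init : {ae mu, forall x, w 0 x = 0}.

Let barrier e t : R := e * expR ((M + 1) * t).

(** The null sets depend on time, so the argument runs over times: let [z] be the infimum of the
    times at which the barrier fails. It holds at [z], by the initial condition or by continuity
    from the left. It then holds shortly after [z], since [w] grows at rate at most [M] times the
    barrier, up to an error, and the barrier at rate [M + 1]; this contradicts the choice of [z]. *)
Lemma gronwall_barrier e t : 0 < e -> 0 <= t <= T ->
  {ae mu, forall x, `|w t x| <= barrier e t}.
Proof.
move=> e0 tT.
have M1 : 0 < M + 1 by rewrite ltr_wpDl.
have barrier_gt0 s : 0 < barrier e s by rewrite mulr_gt0// expR_gt0.
have barrier_le s s' : s <= s' -> barrier e s <= barrier e s'.
  by move=> ss'; rewrite ler_pM2l// ler_expR ler_pM2l.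
apply: contrapT => nPt.
pose S := [set s | 0 <= s <= T /\ ~ {ae mu, forall x, `|w s x| <= barrier e s}].
have St : S t by [].
have S0 : S !=set0 by exists t.
have lbS : lbound S 0 by move=> s [/andP[]].
have hiS : has_inf S by split=> //; exists 0.
pose z := inf S.
have z0 : 0 <= z by exact: lb_le_inf.
have zs s : S s -> z <= s by move=> Ss; apply: ge_inf => //; exists 0.
have zT : z <= T by rewrite (le_trans (zs _ St))//; case/andP: tT.
have Pbelow s : 0 <= s -> s < z -> {ae mu, forall x, `|w s x| <= barrier e s}.
  move=> s0 sz; apply: contrapT => nP.
  have /zs : S s by split=> //; rewrite s0 (le_trans (ltW sz)).
  by rewrite leNgt sz.
have zI : 0 <= z <= T by rewrite z0.
have Pz : {ae mu, forall x, `|w z x| <= barrier e z}.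
  have [zE|zneq0] := eqVneq z 0.
    by apply: filterS w_init => x; rewrite zE => ->; rewrite normr0 ltW.
  have zgt0 : 0 < z by rewrite lt_neqAle eq_sym zneq0.
  have kA := k_bound zI (w_bound zI).
  have [r r0 wr] := w_deriv zI ltr01.
  apply: ae_le_limit => n n0.
  (* [B] bounds the derivative at [z] plus the tolerance 1 of the expansion. The step [h] is at most
     [z] to keep the time nonnegative, less than [r] for the expansion, and at most [n / B] so that
     [w] changes by at most [n]. *)
  pose B := `|M * A| + 1.
  have B0 : 0 < B by rewrite ltr_wpDl.
  pose h := Num.min z (Num.min (r / 2) (n / B)).
  have h0 : 0 < h by rewrite /h !lt_min zgt0 !divr_gt0.
  have hz : h <= z by rewrite /h ge_min lexx.
  have hr : h < r.
    rewrite (@le_lt_trans _ _ (r / 2))//; last by lra.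
    by rewrite /h !ge_min lexx orbT.
  have hB : h * B <= n.
    by rewrite -ler_pdivlMr// /h !ge_min lexx !orbT.
  have sI : 0 <= z - h <= T by rewrite subr_ge0 hz (le_trans _ zT)// gerBl ltW.
  have sh : `|z - h - z| = h by rewrite addrAC subrr add0r normrN gtr0_norm.
  have ws : {ae mu, forall x, `|w (z - h) x| <= barrier e (z - h)}.
    by apply: Pbelow; [case/andP: sI|rewrite gtrBl].
  have := wr _ sI; rewrite sh => /(_ hr) wsz.
  apply: filterS3 kA ws wsz => x kx wx.
  rewrite (_ : z - h - z = - h); last by ring.
  rewrite mulNr mul1r ler_norml => /andP[w1 w2].
  have bb : barrier e (z - h) <= barrier e z by apply: barrier_le; rewrite gerBl ltW.
  have kx' : `|k z x| <= `|M * A| by rewrite (le_trans kx)// ler_norm.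
  have hk : `|h * k z x| <= h * `|M * A| by rewrite normrM gtr0_norm// ler_pM2l.
  move: hk wx hB; rewrite /B !ler_norml => /andP[k1 k2] /andP[x1 x2] hB.
  by apply/andP; split; lra.
(* The tolerance is the barrier at [z] itself: it fills exactly the gap between the rates [M] and
   [M + 1]. *)
have [r r0 wr] := w_deriv zI (barrier_gt0 z).
have [s Ss sr] := inf_adherent r0 hiS.
have zs' := zs _ Ss; have [sI nPs] := Ss; apply: nPs.
have sr' : `|s - z| < r by rewrite ger0_norm ?subr_ge0// ltrBlDl.
have kz := k_bound zI Pz.
apply: filterS3 kz Pz (wr s sI sr') => x kx wx.
have hs0 : 0 <= s - z by rewrite subr_ge0.
rewrite (ger0_norm hs0) ler_norml => /andP[w1 w2].
have hk : `|(s - z) * k z x| <= (s - z) * (M * barrier e z).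
  by rewrite normrM (ger0_norm hs0) ler_wpM2l.
have grow : barrier e z * (1 + (M + 1) * (s - z)) <= barrier e s.
  rewrite /barrier -mulrA ler_pM2l//.
  rewrite [in leRHS](_ : (M + 1) * s = (M + 1) * z + (M + 1) * (s - z));
    last by ring.
  by rewrite expRD ler_pM2l ?expR_gt0// expR_ge1Dx.
move: hk wx; rewrite !ler_norml => /andP[k1 k2] /andP[x1 x2].
by apply/andP; split; lra.
Qed.

Lemma gronwall_ae t : 0 <= t <= T -> {ae mu, forall x, w t x = 0}.
Proof.
move=> tT; have G0 : 0 < expR ((M + 1) * t) by exact: expR_gt0.
have : {ae mu, forall x, `|w t x| <= 0}.
  apply: ae_le_limit => e e0; rewrite add0r.
  have := @gronwall_barrier (e / expR ((M + 1) * t)) t.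
  rewrite /barrier divfK ?gt_eqF//; apply => //.
  by rewrite divr_gt0.
by apply: filterS => x; rewrite normr_le0 => /eqP.
Qed.

End gronwall.

Section product_ae.
Local Open Scope ereal_scope.
Context d (E : measurableType d) (R : realType).
Variable mu : {sigma_finite_measure set E -> \bar R}.

Lemma ae_prod1 (P : E * E -> Prop) : {ae mu \x mu, forall z, P z} ->
  {ae mu, forall x, {ae mu, forall y, P (x, y)}}.
Proof.
move=> [N [mN N0 PN]].
have mx : measurable_fun setT (mu \o xsection N) by exact: measurable_fun_xsection.
have : \int[mu]_x `|(mu \o xsection N) x| = 0.
  by rewrite -[RHS]N0; apply: eq_integral => x _; rewrite gee0_abs.
move/(ae_eq_integral_abs _ measurableT mx); apply: filterS => x /(_ I)/= Nx.
exists (xsection N x); split=> //; first exact: measurable_xsection.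
by move=> y /= nP; rewrite /xsection/= inE; exact: PN.
Qed.

(** Each side says that an iterated integral of the indicator of [N] vanishes; Tonelli equates the
    two. *)
Lemma ae_swap (N : set (E * E)) : measurable N ->
  {ae mu, forall x, {ae mu, forall y, ~ N (x, y)}} ->
  {ae mu, forall y, {ae mu, forall x, ~ N (x, y)}}.
Proof.
move=> mN H.
have mf : measurable_fun setT (fun z : E * E => (\1_N z)%:E : \bar R).
  exact/measurable_EFinP.
have f0 (z : E * E) : 0 <= (\1_N z)%:E :> \bar R by rewrite lee_fin.
have mF := measurable_fun_fubini_tonelli_F (m2 := mu) _ mf f0.
have mG := measurable_fun_fubini_tonelli_G (m1 := mu) _ mf f0.
have F0 : \int[mu]_x \int[mu]_y (\1_N (x, y))%:E = 0.
  rewrite -(integral0 mu setT).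
  apply: ge0_ae_eq_integral => //; first by move=> x _; exact: integral_ge0.
  apply: filterS H => x Hx _ /=; rewrite -(integral0 mu setT).
  apply: ge0_ae_eq_integral => //.
    exact: (measurableT_comp mf (measurable_pair1 x)).
  by apply: filterS Hx => y Nxy _; rewrite indicE memNset.
have G0 : \int[mu]_y \int[mu]_x (\1_N (x, y))%:E = 0.
  by rewrite -[RHS]F0; exact/esym/(fubini_tonelli _ mf f0).
have : \int[mu]_y `|\int[mu]_x (\1_N (x, y))%:E| = 0.
  by rewrite -[RHS]G0; apply: eq_integral => y _; rewrite gee0_abs// integral_ge0.
move/(ae_eq_integral_abs _ measurableT mG); apply: filterS => y /(_ I) Gy.
have : \int[mu]_x `|(\1_N (x, y))%:E| = 0.
  by rewrite -[RHS]Gy; apply: eq_integral => x _; rewrite gee0_abs.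
have mfy : measurable_fun setT (fun x => (\1_N (x, y))%:E : \bar R).
  exact: (measurableT_comp mf (measurable_pair2 y)).
move/(ae_eq_integral_abs _ measurableT mfy); apply: filterS => x /(_ I)/= Nxy NP.
by move: Nxy; rewrite indicE mem_set//= => /eqP; rewrite onee_eq0.
Qed.

(** The difference [g - f] is nonnegative almost everywhere and has integral 0; finiteness of the
    integral of [f] makes the subtraction legitimate. *)
Lemma ae_eq_of_le (f g : E -> \bar R) :
  measurable_fun setT f -> measurable_fun setT g ->
  (forall x, 0 <= f x) -> (forall x, 0 <= g x) ->
  {ae mu, forall x, f x <= g x} -> \int[mu]_x g x <= \int[mu]_x f x ->
  \int[mu]_x f x < +oo -> {ae mu, forall x, f x = g x}.
Proof.
move=> mf mg f0 g0 fg gf foo.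
have intg : mu.-integrable setT g.
  apply/integrableP; split => //; under eq_integral do rewrite gee0_abs//.
  exact: le_lt_trans foo.
have intf : mu.-integrable setT f.
  by apply/integrableP; split => //; under eq_integral do rewrite gee0_abs//.
have fE := integrable_ae measurableT intf.
have gE := integrable_ae measurableT intg.
have mgf : measurable_fun setT (g \- f) by exact: emeasurable_funB.
have eq0 : \int[mu]_x `|(g \- f) x| = 0.
  rewrite (@ae_eq_integral _ _ _ mu setT (g \- f))//.
  - rewrite integralB// (_ : \int[mu]_x g x = \int[mu]_x f x).
      by rewrite subee// integrable_fin_num.
    apply/eqP; rewrite eq_le gf/=; apply: ae_ge0_le_integral => //.
    by apply: filterS fg => x + _.
  - exact: measurableT_comp.
  - apply: filterS2 fE fg => x /(_ I) fx fgx _.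
    by rewrite /= gee0_abs// sube_ge0 ?fx.
move/(ae_eq_integral_abs _ measurableT mgf) : eq0 => gf0.
apply: filterS3 fE gE gf0 => x /(_ I) fx /(_ I) gx /(_ I) /= gfx.
by rewrite -[LHS]add0e -gfx subeK.
Qed.

End product_ae.

(** * The comparison hypothesis *)

Section rate_identity.
Local Open Scope ereal_scope.
Context d (E : measurableType d) (R : realType).
Variable mu : {sigma_finite_measure set E -> \bar R}.
Variables (k : E -> E -> E -> \bar R) (a : E -> E -> \bar R).
Hypotheses (mk : measurable_fun setT (fun z : E * E * E => k z.1.1 z.1.2 z.2))
  (k_ge0 : forall y1 y2 x, 0 <= k y1 y2 x)
  (k_sym : forall y1 y2 x, k y1 y2 x = k y2 y1 x)
  (aE : forall x y, a x y = \int[mu]_y1 k x y y1).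

Lemma measurable_rate : measurable_fun setT (fun z : E * E => a z.1 z.2).
Proof.
rewrite (_ : (fun z => _) = fubini_F mu (fun z : E * E * E => k z.1.1 z.1.2 z.2)).
  exact: measurable_fun_fubini_tonelli_F.
by apply/funext => z; rewrite aE.
Qed.

Lemma pair_rate_ge0 x y : 0 <= a x y.
Proof. by rewrite aE; exact: integral_ge0. Qed.

(* Integrated over [x], the two sides of the comparison hypothesis coincide,
   hence so do they pointwise. *)
Lemma rate_comparison_eq :
  {ae mu, forall x, \int[mu]_y a x y < +oo} ->
  {ae mu \x mu, forall z, \int[mu]_u k z.2 u z.1 <= a z.1 z.2} ->
  {ae mu, forall x, {ae mu, forall y, \int[mu]_u k y u x = a x y}}.
Proof.
move=> afin cmp.
pose H (z : E * E) := \int[mu]_u k z.2 u z.1.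
have mk' : measurable_fun setT (fun z : E * E * E => k z.1.2 z.2 z.1.1).
  have mg : measurable_fun setT (fun z : E * E * E => (z.1.2, z.2, z.1.1)).
    by do 2?apply: measurable_fun_pair => //; exact: measurableT_comp.
  exact: (measurableT_comp mk mg).
have mH : measurable_fun setT H.
  exact: (measurable_fun_fubini_tonelli_F (m2 := mu) _ mk').
have H0 z : 0 <= H z by exact: integral_ge0.
have ma := measurable_rate.
have asym x y : a x y = a y x.
  by rewrite !aE; apply: eq_integral => u _; exact: k_sym.
have mN : measurable [set z : E * E | ~ (H z <= a z.1 z.2)].
  rewrite -[X in measurable X]/(~` [set z : E * E | H z <= a z.1 z.2]).
  by apply: measurableC; rewrite -[X in measurable X]setTI; exact: measurable_lee.
have /(ae_swap mN) cmp' : {ae mu, forall x, {ae mu, forall y,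
    ~ [set z : E * E | ~ (H z <= a z.1 z.2)] (x, y)}}.
  by apply: filterS (ae_prod1 cmp) => x; apply: filterS => y + nP; exact: nP.
pose N := [set z : E * E | H (z.2, z.1) <> a z.2 z.1].
have msw : measurable_fun setT (fun z : E * E => (z.2, z.1)).
  exact: measurable_fun_pair.
have mN2 : measurable N.
  rewrite -[X in measurable X]/(~` [set z : E * E | H (z.2, z.1) = a z.2 z.1]).
  apply: measurableC; rewrite -[X in measurable X]setTI; apply: measurable_eqe => //.
    exact: (measurableT_comp mH msw).
  exact: (measurableT_comp ma msw).
have eqH : {ae mu, forall y, {ae mu, forall x, ~ N (y, x)}}.
  apply: filterS2 afin cmp' => y ay Hy.
  (* Tonelli exchanges [x] and [u], and the integral of [k y u x] over [x] is [a y u]. By symmetry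
     of [a] this is also the integral of the right-hand side of the comparison. *)
  have eqint : \int[mu]_x H (x, y) = \int[mu]_x a y x.
    rewrite /H (fubini_tonelli (m1 := mu) (m2 := mu) (fun z => k y z.2 z.1))//=.
      by apply: eq_integral => u _; rewrite aE.
    have mg : measurable_fun setT (fun z : E * E => (y, z.2, z.1)).
      by do 2?apply: measurable_fun_pair => //; exact: measurable_cst.
    exact: (measurableT_comp mk mg).
  have : {ae mu, forall x, H (x, y) = a x y}.
    apply: (ae_eq_of_le (mu := mu)).
    - exact: (measurableT_comp mH (measurable_pair2 y)).
    - exact: (measurableT_comp ma (measurable_pair2 y)).
    - by move=> x.
    - by move=> x; exact: pair_rate_ge0.
    - by apply: filterS Hy => x /contrapT.
    - by rewrite eqint le_eqVlt; apply/orP; left; apply/eqP/eq_integral => x _.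
    - by rewrite eqint.
  by apply: filterS => x Hx; apply.
apply: filterS (ae_swap mN2 eqH) => x; apply: filterS => y.
by move=> /contrapT.
Qed.

(** The right-hand side is the quantity whose essential supremum is [c4]; the identity thus carries
    the bound [c4] over to the loss operator. *)
Lemma rate_integral_eq :
  {ae mu, forall x, \int[mu]_y a x y < +oo} ->
  {ae mu \x mu, forall z, \int[mu]_u k z.2 u z.1 <= a z.1 z.2} ->
  {ae mu, forall x, \int[mu]_y a x y = \int[mu]_y \int[mu]_u k y u x}.
Proof.
move=> afin cmp; apply: filterS (rate_comparison_eq afin cmp) => x Hx.
apply: ge0_ae_eq_integral => //.
- exact: (measurableT_comp measurable_rate (measurable_pair1 x)).
- apply: (measurable_fun_fubini_tonelli_F (m2 := mu) (fun z => k z.1 z.2 x)) => //.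
  exact: (measurableT_comp mk (measurable_pair2 x)).
- by move=> y _; exact: pair_rate_ge0.
- by move=> y _; exact: integral_ge0.
- by apply: filterS Hx => y <-.
Qed.

End rate_identity.

(** * Stability of the kinetic operator under changes on null sets *)

Section kinetic_congruence.
Local Open Scope ereal_scope.
Context d (E : measurableType d) (R : realType).
Variable mu : {sigma_finite_measure set E -> \bar R}.

(** The functions inserted in the operator may change sign here, so Tonelli is applied to the
    positive and negative parts. *)
Lemma measurable_integral_snd d' (E' : measurableType d') (f : E' * E -> \bar R) :
  measurable_fun setT f -> measurable_fun setT (fun x => \int[mu]_y f (x, y)).
Proof.
move=> mf; rewrite (_ : (fun x => _) =
    (fun x => \int[mu]_y f^\+ (x, y) - \int[mu]_y f^\- (x, y))); last first.
  apply/funext => x; rewrite integralE.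
  by congr (_ - _); apply: eq_integral => y _; rewrite ?funeposE ?funenegE.
apply: emeasurable_funB.
  apply: (measurable_fun_fubini_tonelli_F (m2 := mu)) => //.
  exact: measurable_funepos.
apply: (measurable_fun_fubini_tonelli_F (m2 := mu)) => //.
exact: measurable_funeneg.
Qed.

Variables (k : E -> E -> E -> \bar R) (a : E -> E -> \bar R).
Hypotheses (mk : measurable_fun setT (fun z : E * E * E => k z.1.1 z.1.2 z.2))
  (ma : measurable_fun setT (fun z : E * E => a z.1 z.2)).

Lemma kinetic_congr u v : measurable_fun setT u -> measurable_fun setT v ->
  {ae mu, forall x, u x = v x} ->
  {ae mu, forall x, kinetic mu k a u x = kinetic mu k a v x}.
Proof.
move=> mu_ mv uv; apply: filterS (uv) => x uvx; rewrite /kinetic uvx.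
have mkx : measurable_fun setT (fun z : E * E => k z.1 z.2 x).
  exact: (measurableT_comp mk (measurable_pair2 x)).
have mkw w1 w2 : measurable_fun setT w1 -> measurable_fun setT w2 ->
    measurable_fun setT (fun z : E * E => k z.1 z.2 x * (w1 z.1)%:E * (w2 z.2)%:E).
  move=> m1 m2; apply: emeasurable_funM.
    apply: emeasurable_funM => //.
    by apply/measurable_EFinP; exact: measurableT_comp.
  by apply/measurable_EFinP; exact: measurableT_comp.
have -> : \int[mu]_y1 \int[mu]_y2 (k y1 y2 x * (u y1)%:E * (u y2)%:E) =
    \int[mu]_y1 \int[mu]_y2 (k y1 y2 x * (v y1)%:E * (v y2)%:E).
  (* The inner factor is exchanged first, for every [y1], and then the outer one. *)
  transitivity (\int[mu]_y1 \int[mu]_y2 (k y1 y2 x * (u y1)%:E * (v y2)%:E)).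
    apply: eq_integral => y1 _; apply: ae_eq_integral => //.
    - exact: (measurableT_comp (mkw _ _ mu_ mu_) (measurable_pair1 y1)).
    - exact: (measurableT_comp (mkw _ _ mu_ mv) (measurable_pair1 y1)).
    - by apply: filterS uv => y2 /= ->.
  apply: ae_eq_integral => //.
  - exact: (measurable_integral_snd (mkw _ _ mu_ mv)).
  - exact: (measurable_integral_snd (mkw _ _ mv mv)).
  - by apply: filterS uv => y1 /= ->.
have -> // : \int[mu]_y (a x y * (u y)%:E) = \int[mu]_y (a x y * (v y)%:E).
have max : measurable_fun setT (a x).
  exact: (measurableT_comp ma (measurable_pair1 x)).
apply: ae_eq_integral => //.
- exact: measurable_wint_integrand.
- exact: measurable_wint_integrand.
- by apply: filterS uv => y /= ->.
Qed.

End kinetic_congruence.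

Section kinetic_ae.
Context d (E : measurableType d) (R : realType).
Variable mu : {sigma_finite_measure set E -> \bar R}.
Variables (k : E -> E -> E -> \bar R) (a : E -> E -> \bar R) (K C : R).
Hypotheses (K_gt0 : 0 < K) (C_gt0 : 0 < C).
Hypotheses (mk : measurable_fun setT (fun z : E * E * E => k z.1.1 z.1.2 z.2))
  (k_ge0 : forall y1 y2 x, (0 <= k y1 y2 x)%E).
Hypotheses (ma : measurable_fun setT (fun z : E * E => a z.1 z.2))
  (a_ge0 : forall x y, (0 <= a x y)%E).
Hypothesis k_le : {ae mu, forall x,
  (\int[mu]_y1 \int[mu]_y2 k y1 y2 x <= K%:E)%E}.
Hypothesis a_le : {ae mu, forall x, (\int[mu]_y a x y <= K%:E)%E}.
Hypothesis k_le_a : {ae mu, forall x,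
  {ae mu, forall y, (\int[mu]_y2 k y y2 x <= a x y)%E}}.

(* The bounds are made to hold everywhere by zeroing the kernels on a null set. *)
Lemma kinetic_ae : exists D M B : R,
  [/\ 0 <= D, 0 <= M,
      forall p0, box C p0 -> exists p : R -> E -> R,
        [/\ p 0 = p0, forall t, 0 <= t -> box C (p t) &
          forall s t, 0 <= s -> 0 <= t -> s != t -> {ae mu, forall x,
            (`|((p s x - p t x) / (s - t))%:E - kinetic mu k a (p t) x| <=
             (D * `|s - t|)%:E)%E}],
      forall u v e, box C u -> box C v -> (forall y, `|u y - v y| <= e) ->
        {ae mu, forall x, (`|kinetic mu k a u x - kinetic mu k a v x| <=
          (M * e)%:E)%E} &
      forall u, box C u -> {ae mu, forall x, (`|kinetic mu k a u x| <= B%:E)%E}].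
Proof.
have [N [mN N0 PN]] := filterI k_le (filterI a_le k_le_a).
have goodN x : ~ N x -> [/\ (\int[mu]_y1 \int[mu]_y2 k y1 y2 x <= K%:E)%E,
    (\int[mu]_y a x y <= K%:E)%E &
    {ae mu, forall y, (\int[mu]_y2 k y y2 x <= a x y)%E}].
  move=> nN; suff [? []] : ([set x | (\int[mu]_y1 \int[mu]_y2 k y1 y2 x <= K%:E)%E]
    `&` ([set x | (\int[mu]_y a x y <= K%:E)%E] `&`
    [set x | {ae mu, forall y, (\int[mu]_y2 k y y2 x <= a x y)%E}])) x by split.
  by apply: contrapT => nP; apply: nN; exact: PN.
(* The cut-off acts on the output variable [x] alone, so outside [N] the operator is literally
   unchanged. *)
pose i x : \bar R := (\1_(~` N) x)%:E.
pose k' y1 y2 x := (i x * k y1 y2 x)%E.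
pose a' x y := (i x * a x y)%E.
have iN x : N x -> i x = 0%E by move=> Nx; rewrite /i indicE memNset//; apply.
have inN x : ~ N x -> i x = 1%E by move=> Nx; rewrite /i indicE mem_set.
have i_ge0 x : (0 <= i x)%E by rewrite lee_fin.
have mi : measurable_fun setT i.
  by apply/measurable_EFinP/measurable_indic; exact: measurableC.
have kN y1 y2 x : N x -> k' y1 y2 x = 0%E.
  by move=> /iN; rewrite /k' => ->; rewrite mul0e.
have aN x y : N x -> a' x y = 0%E.
  by move=> /iN; rewrite /a' => ->; rewrite mul0e.
have knN y1 y2 x : ~ N x -> k' y1 y2 x = k y1 y2 x.
  by move=> /inN; rewrite /k' => ->; rewrite mul1e.
have anN x y : ~ N x -> a' x y = a x y.
  by move=> /inN; rewrite /a' => ->; rewrite mul1e.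
have mk' : measurable_fun setT (fun z : E * E * E => k' z.1.1 z.1.2 z.2).
  by apply: emeasurable_funM => //; exact: measurableT_comp.
have ma' : measurable_fun setT (fun z : E * E => a' z.1 z.2).
  by apply: emeasurable_funM => //; exact: measurableT_comp.
have k'_ge0 y1 y2 x : (0 <= k' y1 y2 x)%E by rewrite mule_ge0.
have a'_ge0 x y : (0 <= a' x y)%E by rewrite mule_ge0.
have k'_le x : (\int[mu]_y1 \int[mu]_y2 k' y1 y2 x <= K%:E)%E.
  have [Nx|/[dup] nNx /goodN[kx _ _]] := pselect (N x).
    rewrite integral0_eq ?lee_fin ?ltW// => y1 _.
    by rewrite integral0_eq// => y2 _; rewrite kN.
  by under eq_integral do under eq_integral do rewrite knN//.
have a'_le x : (\int[mu]_y a' x y <= K%:E)%E.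
  have [Nx|/[dup] nNx /goodN[_ + _]] := pselect (N x).
    by rewrite integral0_eq ?lee_fin ?ltW// => y _; rewrite aN.
  by congr (_ <= _)%E; apply: eq_integral => y1 _; rewrite anN.
have k'_le_a' x : {ae mu, forall y, (\int[mu]_y2 k' y y2 x <= a' x y)%E}.
  have [Nx|/[dup] nNx /goodN[_ _]] := pselect (N x).
    apply: aeW => y; rewrite aN// integral0_eq// => y2 _.
    by rewrite kN.
  apply: filterS => y; rewrite anN//; congr (_ <= _)%E.
  by apply: eq_integral => y2 _; rewrite knN.
have kinE u : {ae mu, forall x, kinetic mu k' a' u x = kinetic mu k a u x}.
  exists N; split=> // x /=; apply: contra_notP => nN; rewrite /kinetic.
  under eq_integral do under eq_integral do rewrite knN//.
  by under [X in (_ - _ * X)%E]eq_integral do rewrite anN//.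
exists (4 * C * K * (C * C * K)), (4 * C * K), (C * C * K); split.
- by rewrite !mulr_ge0// ltW.
- by rewrite !mulr_ge0// ltW.
- move=> p0 bp.
  have [p [pE pC dp]] := kinetic_flow K_gt0 C_gt0 mk' k'_ge0 ma' a'_ge0
    k'_le a'_le k'_le_a' bp.
  exists p; split => // s t s0 t0 st; apply: filterS (kinE (p t)) => x <-.
  by rewrite -mulrA; exact: dp.
- move=> u v e bu bv uv; apply: filterS2 (kinE u) (kinE v) => x <- <-.
  exact: (kinetic_lip C_gt0 mk' k'_ge0 ma' a'_ge0 k'_le a'_le bu bv uv).
- move=> u bu; apply: filterS (kinE u) => x <-.
  exact: (kinetic_bound C_gt0 mk' k'_ge0 ma' a'_ge0 k'_le a'_le).
Qed.

End kinetic_ae.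

(** * Essentially bounded solutions *)

Section Linf_norm_ae.
Context d (E : measurableType d) (R : realType) (mu : {measure set E -> \bar R}).

(** The norm is an essential supremum only if the space has positive mass. Otherwise it is 0 by
    convention, and every property holds almost everywhere. *)
Lemma Lnorm_oo_leP (f : E -> \bar R) (e : R) : 0 <= e ->
  ('N[mu]_+oo[f] <= e%:E)%E <-> {ae mu, forall x, (`|f x| <= e%:E)%E}.
Proof.
move=> e0; rewrite unlock /Lnorm; case: ifPn => [_|].
  by split=> [/ess_supP//|H]; exact/ess_supP.
rewrite -leNgt => mu0; split=> [_|_]; last by rewrite lee_fin.
by exists setT; split => //; apply/eqP; rewrite eq_le mu0 measure_ge0.
Qed.

Lemma Lfun_ooP (f : E -> R) : (f \in Lfun mu +oo) <->
  measurable_fun setT f /\ ('N[mu]_+oo[EFin \o f] < +oo)%E.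
Proof.
split=> [/andP[mf ff]|[mf ff]]; first by move: mf ff; rewrite !inE.
by apply/andP; rewrite !inE.
Qed.

End Linf_norm_ae.

Section clamp.
Context (R : realType).

(** Truncation to [[a, b]]: it makes almost-everywhere bounds hold everywhere without leaving the
    class of the function. *)
Definition clamp (a b x : R) := Num.max a (Num.min b x).

Lemma clamp_id a b x : a <= x <= b -> clamp a b x = x.
Proof. by move=> /andP[ax xb]; rewrite /clamp min_r// max_r. Qed.

Lemma clamp_itv a b x : a <= b -> a <= clamp a b x <= b.
Proof. by move=> ab; rewrite /clamp le_max lexx ge_max ab ge_min lexx. Qed.

Lemma clamp_stable a b l u x : a <= u -> l <= b -> l <= x <= u ->
  l <= clamp a b x <= u.
Proof.
move=> au lb /andP[lx xu].
by rewrite /clamp le_max le_min ge_max ge_min lb lx au xu !orbT.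
Qed.

Lemma measurable_clamp d (E : measurableType d) (a b f : E -> R) :
  measurable_fun setT a -> measurable_fun setT b -> measurable_fun setT f ->
  measurable_fun setT (fun x => clamp (a x) (b x) (f x)).
Proof.
by move=> ma mb mf; apply: measurable_maxr => //; exact: measurable_minr.
Qed.

End clamp.

Section well_posedness.
Context (R : realType) (d : nat).
Local Notation E := (Rd R d).
Local Notation mu := (leb_rec R d).
Variables (c : E -> E -> E -> E -> R) (C T : R).
Hypotheses (hc : is_rate c) (C_gt0 : 0 < C).

Lemma ctilde_ge0 y1 y2 x : (0 <= ctilde c y1 y2 x)%E.
Proof. by apply: integral_ge0 => y _; rewrite lee_fin rate_ge0. Qed.

Lemma ctilde_sym y1 y2 x : ctilde c y1 y2 x = ctilde c y2 y1 x.
Proof. by apply: eq_integral => y _; rewrite (rate_symx hc). Qed.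

Lemma measurable_ctilde :
  measurable_fun setT (fun z : E * E * E => ctilde c z.1.1 z.1.2 z.2).
Proof.
apply: (measurable_fun_fubini_tonelli_F (m2 := mu)
  (fun z : E * E * E * E => (c z.1.1.1 z.1.1.2 z.1.2 z.2)%:E)).
  by apply/measurable_EFinP; exact: (rate_measurable hc).
by move=> z; rewrite lee_fin; exact: (rate_ge0 hc).
Qed.

Lemma a1E x y : a1 c x y = (\int[mu]_y1 ctilde c x y y1)%E.
Proof. by []. Qed.

Lemma measurable_a1 : measurable_fun setT (fun z : E * E => a1 c z.1 z.2).
Proof. exact: (measurable_rate measurable_ctilde ctilde_ge0 a1E). Qed.

Lemma a1_ge0 x y : (0 <= a1 c x y)%E.
Proof. exact: (pair_rate_ge0 ctilde_ge0 a1E). Qed.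

Variables (M B : R).
Hypothesis M_ge0 : 0 <= M.
Hypothesis rhs_lip : forall u v e, box C u -> box C v ->
  (forall y, `|u y - v y| <= e) -> {ae mu, forall x,
    (`|kinetic_rhs c u x - kinetic_rhs c v x| <= (M * e)%:E)%E}.
Hypothesis rhs_bound : forall u, box C u ->
  {ae mu, forall x, (`|kinetic_rhs c u x| <= B%:E)%E}.

Lemma ae_kinetic_rhs u v : measurable_fun setT u -> measurable_fun setT v ->
  {ae mu, forall x, u x = v x} ->
  {ae mu, forall x, kinetic_rhs c u x = kinetic_rhs c v x}.
Proof. exact: (kinetic_congr measurable_ctilde measurable_a1). Qed.

Definition ae_box (u : E -> R) :=
  measurable_fun setT u /\ {ae mu, forall x, 0 <= u x <= C}.

Lemma box_clamp u : ae_box u -> box C (clamp 0 C \o u) /\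
  {ae mu, forall x, u x = (clamp 0 C \o u) x}.
Proof.
move=> [mu_ ub]; split; last by apply: filterS ub => x ux /=; rewrite clamp_id.
by split => [|x]; [exact: measurable_clamp|rewrite clamp_itv ?ltW].
Qed.

Lemma ae_rhs_fin u : ae_box u -> {ae mu, forall x, kinetic_rhs c u x \is a fin_num}.
Proof.
move=> bu; have [bv uv] := box_clamp bu.
apply: filterS2 (rhs_bound bv) (ae_kinetic_rhs bu.1 bv.1 uv) => x + ->.
by move=> /le_lt_trans/(_ (ltry _)); rewrite -fin_num_abs.
Qed.

(** Representatives that satisfy the hypotheses of [rhs_lip] at every point are found by truncation:
    [u] and [v] to [[0, C]], then [v] to within [e] of [u]. The second truncation does not leave
    [[0, C]], by [clamp_stable]. *)
Lemma ae_rhs_lip u v e : ae_box u -> ae_box v ->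
  {ae mu, forall x, `|u x - v x| <= e} -> {ae mu, forall x,
    `|fine (kinetic_rhs c u x) - fine (kinetic_rhs c v x)| <= M * e}.
Proof.
(* For negative [e] the assumed inequality is impossible at any point, so the conclusion follows
   from it pointwise. *)
move=> bu bv uv; have [e0|e0] := leP 0 e; last first.
  by apply: filterS uv => x; rewrite leNgt (lt_le_trans e0).
have [bu' uu'] := box_clamp bu.
pose v' x := clamp ((clamp 0 C \o u) x - e) ((clamp 0 C \o u) x + e)
  ((clamp 0 C \o v) x).
have [bv' vv'] := box_clamp bv.
have mv' : measurable_fun setT v'.
  apply: measurable_clamp; last by case: bv'.
    by apply: measurable_funB => //; case: bu'.
  by apply: measurable_funD => //; case: bu'.
have close y : `|(clamp 0 C \o u) y - v' y| <= e.
  rewrite distrC ler_distl; apply: clamp_itv.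
  by rewrite lerD2l (le_trans _ e0)// oppr_le0.
have bv2 : box C v'.
  split => // x; have [_ /(_ x)/andP[u0 u1]] := bu'.
  have [_ /(_ x)/andP[v0 v1]] := bv'.
  apply: clamp_stable; rewrite ?v0//; first by rewrite lerBlDr (le_trans u1)// lerDl.
  exact: addr_ge0.
have vE : {ae mu, forall x, v x = v' x}.
  apply: filterS3 uu' vv' uv => x u1 v1 uvx; rewrite /v' -u1 -v1 clamp_id//.
  by rewrite -ler_distl distrC.
apply: filterS3 (rhs_lip bu' bv2 close)
  (filterI (ae_kinetic_rhs bu.1 bu'.1 uu') (ae_kinetic_rhs bv.1 mv' vE))
  (filterI (ae_rhs_fin bu) (ae_rhs_fin bv)) => x H [e1 e2] [fu fv].
by move: H; rewrite -e1 -e2 -{1}(fineK fu) -{1}(fineK fv).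
Qed.

Section solution.
Variables (p0 : E -> R) (q : R -> E -> R).
Hypotheses (solq : nonneg_solution c T p0 q) (bndq : bounded_by T C q).

Lemma solution_box t : 0 <= t <= T -> ae_box (q t).
Proof.
move=> tT; have /Lfun_ooP[mq _] := sol_Linf solq tT; split => //.
have /(Lnorm_oo_leP _ _ (ltW C_gt0)) qC := bndq tT.
apply: filterS2 (sol_ge0 solq tT) qC => x /= q0.
by rewrite lee_fin ger0_norm// q0.
Qed.

(** Convergence of the difference quotients in norm, rewritten as a first-order expansion almost
    everywhere, which is the form used by Gronwall's lemma. The case [s = t], excluded from the
    limit, is trivial. *)
Lemma solution_increment t e : 0 <= t <= T -> 0 < e -> exists2 r, 0 < r &
  forall s, 0 <= s <= T -> `|s - t| < r -> {ae mu, forall x,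
    `|q s x - q t x - (s - t) * fine (kinetic_rhs c (q t) x)| <= e * `|s - t|}.
Proof.
move=> tT e0.
have lte : (0 < e%:E)%E by rewrite lte_fin.
have := sol_deriv solq tT (open_ereal_lt' lte).
rewrite /= => /nbhs_ballP[r /= r0 Hr]; exists r => // s sT st.
have [->|sneqt] := eqVneq s t.
  by apply: aeW => x; rewrite !subrr mul0r subrr normr0 mulr0.
have : (Linf_norm (fun x => ((q s x - q t x) / (s - t))%:E -
    kinetic_rhs c (q t) x) < e%:E)%E.
  by apply: Hr => //; rewrite /ball/= distrC.
move=> /ltW/(Lnorm_oo_leP _ _ (ltW e0)).
apply: filterS2 (ae_rhs_fin (solution_box tT)) => x fx.
rewrite -[in X in (X -> _)](fineK fx) -EFinB abse_EFin lee_fin => H.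
have st0 : s - t != 0 by rewrite subr_eq0.
have -> : q s x - q t x - (s - t) * fine (kinetic_rhs c (q t) x) =
    ((q s x - q t x) / (s - t) - fine (kinetic_rhs c (q t) x)) * (s - t).
  by field.
by rewrite normrM ler_wpM2r.
Qed.

End solution.

(** Gronwall applied to [q1 - q2], which is at most [C] in absolute value since both functions lie
    between 0 and [C]. Each expansion gets half of the tolerance. *)
Lemma solution_unique p0 q1 q2 :
  nonneg_solution c T p0 q1 -> bounded_by T C q1 ->
  nonneg_solution c T p0 q2 -> bounded_by T C q2 ->
  forall t, 0 <= t <= T -> {ae mu, forall x, q1 t x = q2 t x}.
Proof.
move=> s1 b1 s2 b2 t tT.
pose k t x := fine (kinetic_rhs c (q1 t) x) - fine (kinetic_rhs c (q2 t) x).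
suff : {ae mu, forall x, q1 t x - q2 t x = 0}.
  by apply: filterS => x /eqP; rewrite subr_eq0 => /eqP.
apply: (@gronwall_ae _ E R mu T M C (fun t x => q1 t x - q2 t x) k) => //.
- move=> {tT}t e tT e0; have e20 : 0 < e / 2 by rewrite divr_gt0.
  have [r1 r10 H1] := solution_increment s1 b1 tT e20.
  have [r2 r20 H2] := solution_increment s2 b2 tT e20.
  exists (Num.min r1 r2); first by rewrite lt_min r10.
  move=> s sT; rewrite lt_min => /andP[sr1 sr2].
  apply: filterS2 (H1 s sT sr1) (H2 s sT sr2) => x; rewrite /k.
  set f1 := fine _; set f2 := fine _ => h1 h2.
  have -> : q1 s x - q2 s x - (q1 t x - q2 t x) - (s - t) * (f1 - f2) =
    (q1 s x - q1 t x - (s - t) * f1) - (q2 s x - q2 t x - (s - t) * f2) by ring.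
  by apply: le_trans (ler_normB _ _) _; lra.
- move=> {tT}t tT; have [_ c1] := solution_box s1 b1 tT.
  have [_ c2] := solution_box s2 b2 tT.
  apply: filterS2 c1 c2 => x /andP[x0 x1] /andP[y0 y1].
  by rewrite ler_norml; apply/andP; split; lra.
- move=> {tT}t e tT; apply: ae_rhs_lip; first exact: solution_box s1 b1 _ tT.
  exact: solution_box s2 b2 _ tT.
- by apply: filterS2 (sol_init s1) (sol_init s2) => x -> ->; rewrite subrr.
Qed.

End well_posedness.

(** * From a flow with uniform error bounds to a solution in [L^oo] *)

Section existence.
Context (R : realType) (d : nat).
Local Notation E := (Rd R d).
Local Notation mu := (leb_rec R d).
Variables (c : E -> E -> E -> E -> R) (C T : R).
Hypotheses (C_gt0 : 0 < C).

Lemma Lnorm_box u : box C u -> ('N[mu]_+oo[EFin \o u] <= C%:E)%E.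
Proof.
move=> [_ ub]; apply/Lnorm_oo_leP; first exact: ltW.
by apply: aeW => x; have /andP[u0 u1] := ub x; rewrite lee_fin ger0_norm.
Qed.

Lemma flow_solution (D : R) p0 (p : R -> E -> R) : 0 <= D ->
  {ae mu, forall x, p 0 x = p0 x} ->
  (forall t, 0 <= t -> box C (p t)) ->
  (forall s t, 0 <= s -> 0 <= t -> s != t -> {ae mu, forall x,
    (`|((p s x - p t x) / (s - t))%:E - kinetic_rhs c (p t) x| <=
      (D * `|s - t|)%:E)%E}) ->
  nonneg_solution c T p0 p /\ bounded_by T C p.
Proof.
move=> D0 pE pC dp; split; last first.
  by move=> t /andP[t0 _]; exact/Lnorm_box/pC.
split => //.
- move=> t /andP[t0 _]; apply/Lfun_ooP; split; first by case: (pC t t0).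
  by rewrite (le_lt_trans (Lnorm_box (pC t t0)))// ltry.
- by move=> t /andP[t0 _]; apply: aeW => x; have [_ /(_ x)/andP[]] := pC t t0.
move=> t /andP[t0 tT].
have lim0 : (D * `|s - t|)%:E @[s --> within [set s | 0 <= s <= T] t^'] --> 0%E.
  (* Two restrictions are dropped: to [[0, T]] and to [s != t]. *)
  apply: cvg_within_filter; apply: cvg_within_filter.
  apply: cvg_EFin; first exact: nearW.
  rewrite [X in _ --> X](_ : 0 = D * `|t - t|); last by rewrite subrr normr0 mulr0.
  apply: cvgMr; apply: cvg_norm; apply: cvgB; first exact: cvg_id.
  exact: cvg_cst.
apply: (squeeze_cvge _ (cvg_cst _) lim0).
rewrite near_withinE; near=> s => /andP[s0 sT].
rewrite Lnorm_ge0/=; apply/Lnorm_oo_leP; first by rewrite mulr_ge0.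
apply: dp => //; near: s; exact: nbhs_dnbhs_neq.
Unshelve. all: by end_near. Qed.

End existence.

Unset Implicit Arguments.
Local Open Scope ereal_scope.

Theorem proposition4p6 (R : realType) (d : nat) (hd : (0 < d)%N)
    (c : Rd R d -> Rd R d -> Rd R d -> Rd R d -> R) (hc : is_rate c)
    (hloss : loss_well_defined c)
    (C : R) (hC : (0 < C)%R)
    (p0 : Rd R d -> R) (hp0 : Linf p0)
    (hp0_ge0 : {ae leb, forall x, (0 <= p0 x)%R})
    (hp0_le : Linf_norm (EFin \o p0) <= C%:E)
    (hc1 : c1 c < +oo) (hc4 : c4 c < +oo)
    (hcmp : {ae leb \x leb, forall z : Rd R d * Rd R d,
      \int[leb]_u1 \int[leb]_u2 (c z.2 u1 z.1 u2)%:E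
      <= \int[leb]_u1 \int[leb]_u2 (c z.1 z.2 u1 u2)%:E})
    (T : R) (hT : (0 < T)%R) :
  exists p : R -> Rd R d -> R,
    [/\ nonneg_solution c T p0 p,
        bounded_by T C p &
        forall q : R -> Rd R d -> R,
          nonneg_solution c T p0 q -> bounded_by T C q ->
          forall t, (0 <= t <= T)%R -> {ae leb, forall x, q t x = p t x}].
Proof.
pose mu := leb_rec R d.
have mk := measurable_ctilde hc.
have k0 := ctilde_ge0 hc.
have ma := measurable_a1 hc.
have a0 := a1_ge0 hc.
(* The convergence of the loss integral is used for the constant function 1. *)
have afin : {ae mu, forall x, \int[mu]_y a1 c x y < +oo}.
  have L1 : Linf (cst 1%R : Rd R d -> R).
    apply/Lfun_ooP; split; first exact: measurable_cst.
    apply: (@le_lt_trans _ _ 1%:E); last exact: ltry.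
    by apply/Lnorm_oo_leP => //; apply: aeW => x; rewrite lee_fin normr1.
  apply: filterS (hloss _ L1) => x /(integrable_lty measurableT).
  by under eq_integral do rewrite mule1.
(* The maximum with 1 keeps [K] positive even when [c4] vanishes; the step size [(C * K)^-1] needs
   this. *)
have [K K0 cK] : exists2 K : R, (0 < K)%R & c4 c <= K%:E.
  move: hc4; case: (c4 c) => [r _| |] //; last by exists 1%R; rewrite ?leNye.
  by exists (Num.max 1 r)%R; rewrite ?lt_max ?ltr01// lee_fin le_max lexx orbT.
have kK : {ae mu, forall x, \int[mu]_y1 \int[mu]_y2 ctilde c y1 y2 x <= K%:E}.
  by apply: filterS (ess_sup_ge mu _) => x /le_trans; apply.
have aK : {ae mu, forall x, \int[mu]_y a1 c x y <= K%:E}.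
  have := rate_integral_eq mk k0 (ctilde_sym hc) (@a1E _ _ c) afin hcmp.
  by apply: filterS2 kK => x xK ->.
have ka : {ae mu, forall x,
    {ae mu, forall y, \int[mu]_u ctilde c y u x <= a1 c x y}}.
  have := rate_comparison_eq mk k0 (ctilde_sym hc) (@a1E _ _ c) afin hcmp.
  by apply: filterS => x; apply: filterS => y ->.
have [D [M [B [D0 M0 flow lip bnd]]]] := kinetic_ae K0 hC mk k0 ma a0 kK aK ka.
have bp0 : ae_box C p0.
  have /Lfun_ooP[mp0 _] := hp0; split => //.
  have /(Lnorm_oo_leP _ _ (ltW hC)) p0C := hp0_le.
  by apply: filterS2 hp0_ge0 p0C => x h0; rewrite lee_fin ger0_norm// h0.
(* The flow starts from the truncation of [p0], which agrees with [p0] almost everywhere. *)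
have [bq p0q] := box_clamp hC bp0.
have [p [pE pC dp]] := flow _ bq.
have init : {ae mu, forall x, p 0%R x = p0 x}.
  by rewrite pE; apply: filterS p0q => x.
have [sp bp] := flow_solution T hC D0 init pC dp.
exists p; split => // q sq bdq t tT.
exact: (solution_unique hc hC M0 lip bnd sq bdq sp bp).
Qed.
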